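(* Let $(M,g,\circ,e,\mathcal{E},\kappa)$ be a non-trivial semi-simple CDV-structure. Let $\nabla$ be the Levi-Civita connection of $g$ and $D'$ the $(1,0)$-part of the Chern connection of $h=g(\cdot,\kappa\,\cdot)$. Then $D'\neq\nabla$.
   Context: Frobenius manifold. $M$ is a complex analytic manifold of dimension $m$, $\Theta_M$ is its sheaf of holomorphic vector fields; $g$ is a holomorphic symmetric non-degenerate bilinear form on $\Theta_M$ with Levi-Civita connection $\nabla$; $\circ$ is a holomorphic commutative associative product on $\Theta_M$ with unit field $e$; $\mathcal{E}$ is a holomorphic vector field (Euler field). These satisfy: $\nabla$ is flat; $g(X\circ Y,Z)=g(X,Y\circ Z)$; $\nabla e=0$; with $c(X,Y,Z):=g(X\circ Y,Z)$ the tensor $(\nabla_Zc)(U,V,W)$ is symmetric in its four arguments; $\nabla(\nabla\mathcal{E})=0$, $\mathcal{L}_{\mathcal{E}}(\circ)=\circ$, and $\mathcal{L}_{\mathcal{E}}(g)=(2-d)g$ for some constant $d$. It is semi-simple if near every point there are holomorphic coordinates $(u^1,\dots,u^m)$, called canonical, with $\partial_{u^\alpha}\circ\partial_{u^\beta}=\delta_{\alpha\beta}\partial_{u^\alpha}$. Coordinates $(t^i)$ are $\nabla$-flat if $\nabla\partial_{t^i}=0$ for all $i$. Locally, in flat coordinates $(t^i)$, there is a potential function $F$ with $\partial^3F/\partial t^i\partial t^j\partial t^k=g(\partial_{t^i}\circ\partial_{t^j},\partial_{t^k})$. The Frobenius manifold is trivial if, locally, the potential function is a polynomial of degree three when expressed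 in some holomorphic $\nabla$-flat local coordinates. A CDV-structure is non-trivial (semi-simple) if the underlying Frobenius manifold is non-trivial (semi-simple). $\mathcal{T}_M^{(1,0)}$ is the $C^\infty$ complex vector bundle underlying the holomorphic tangent bundle, with its operator $\overline\partial$; $g$, $\circ$ are extended $C^\infty$-linearly and $\nabla$ is extended to a $(1,0)$-connection on $\mathcal{T}_M^{(1,0)}$. The Chern connection $D_h=D'+\overline\partial$ of a Hermitian pseudo-metric $h$ is the unique connection with $(0,1)$-part $\overline\partial$ and $D_h(h)=0$. CDV-structure. Given a Frobenius manifold and a smooth fiberwise $\mathbb{C}$-anti-linear involution $\kappa$ of $\mathcal{T}_M^{(1,0)}$, put $h:=g(\cdot,\kappa\,\cdot)$, $D:=D_h$ with $(1,0)$-part $D'$ and $(0,1)$-part $D''=\overline\partial$, $C_XY:=-X\circ Y$, $\tilde C:=\kappa C\kappa$ (i.e. $\tilde C_{\overline X}=\kappa C_X\kappa$), $\mathcal{U}:=\mathcal{E}\circ$, $\mathcal{Q}:=D_{\mathcal{E}}-\mathcal{L}_{\mathcal{E}}-\frac{2-d}{2}\mathrm{Id}$. One says $(M,g,\circ,e,\mathcal{E},\kappa)$ is a CDV-structure if $d\in\mathbb{R}$, $D_ee=0$, and $(\mathcal{T}_M^{(1,0)}\to M,D,C,\tilde C,\kappa,h,\mathcal{U},\mathcal{Q})$ is a CV-structure, i.e.: (1) $(C+D'')^2=0$, $(\tilde C+D')^2=0$, $D'(C)=0$, $D''(\tilde C)=0$, $D'D''+D''D'=-(C\tilde C+\tilde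 CC)$; (2) $\kappa^2=\mathrm{Id}$, $D(\kappa)=0$ (i.e. $D'_X\kappa=\kappa D''_{\overline X}$ and $D''_{\overline X}\kappa=\kappa D'_X$), $\kappa C\kappa=\tilde C$; (3) $h$ is a Hermitian pseudo-metric (linear on the left, semi-linear on the right, non-degenerate, $h(b,a)=\overline{h(a,b)}$), real-valued on $\ker(\kappa-\mathrm{Id})$, with $h(C_Xa,b)=h(a,\tilde C_{\overline X}b)$ and $D(h)=0$; (4) $[C,\mathcal{U}]=0$, $D'(\mathcal{U})-[C,\mathcal{Q}]+C=0$, $D''(\mathcal{U})=0$, $D'(\mathcal{Q})+[C,\kappa\mathcal{U}\kappa]=0$, $\kappa\mathcal{Q}\kappa+\mathcal{Q}=0$, $h(\mathcal{U}a,b)=h(a,\kappa\mathcal{U}\kappa b)$, $h(\mathcal{Q}a,b)=h(a,\mathcal{Q}b)$. *)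

(* Defs.v *)
From HB Require Import structures.
From mathcomp Require Import all_boot all_order all_algebra.
From mathcomp Require Import all_classical all_reals all_analysis.
From mathcomp Require Import complex.
(* The notations of mpoly clash with those of analysis. *)
From mathcomp Require Import -(notations) mpoly.

Set Implicit Arguments.
Unset Strict Implicit.
Unset Printing Implicit Defensive.

Import Order.TTheory GRing.Theory Num.Theory.
Import numFieldNormedType.Exports.
Local Open Scope classical_set_scope.
Local Open Scope ring_scope.

(* The type ascription makes the norm topology of numeric fields available on
   the complex numbers R[i], hence on row vectors over them. *)
Definition Cx (R : realType) : numClosedFieldType := R[i]%C.

Definition ofR2 (R : realType) (m : nat) (xy : 'rV[R]_m * 'rV[R]_m)
  : 'rV[Cx R]_m := \row_k (xy.1 0 k +i* xy.2 0 k)%C.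

Definition toR2 (R : realType) (m : nat) (z : 'rV[Cx R]_m)
  : 'rV[R]_m * 'rV[R]_m :=
  (\row_k complex.Re (z 0 k), \row_k complex.Im (z 0 k)).

Definition re_part (R : realType) (m : nat) (F : 'rV[Cx R]_m -> Cx R)
  (xy : 'rV[R]_m * 'rV[R]_m) : R := complex.Re (F (ofR2 xy)).

Definition im_part (R : realType) (m : nat) (F : 'rV[Cx R]_m -> Cx R)
  (xy : 'rV[R]_m * 'rV[R]_m) : R := complex.Im (F (ofR2 xy)).

Definition rderiv (R : realType) (m : nat) (w : 'rV[R]_m * 'rV[R]_m)
  (F : 'rV[Cx R]_m -> Cx R) (z : 'rV[Cx R]_m) : Cx R :=
  ('D_w (re_part F) (toR2 z) +i* 'D_w (im_part F) (toR2 z))%C.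

(* Wirtinger operators
     d/dz^k    = (d/dx^k - i d/dy^k) / 2,
     d/dzbar^k = (d/dx^k + i d/dy^k) / 2. *)
Definition dz (R : realType) (m : nat) (k : 'I_m)
  (F : 'rV[Cx R]_m -> Cx R) (z : 'rV[Cx R]_m) : Cx R :=
  2^-1 * (rderiv (delta_mx 0 k, 0) F z
          - ('i%C : Cx R) * rderiv (0, delta_mx 0 k) F z).

Definition dzbar (R : realType) (m : nat) (k : 'I_m)
  (F : 'rV[Cx R]_m -> Cx R) (z : 'rV[Cx R]_m) : Cx R :=
  2^-1 * (rderiv (delta_mx 0 k, 0) F z
          + ('i%C : Cx R) * rderiv (0, delta_mx 0 k) F z).

Fixpoint diff_upto (R : realType) (m : nat) (n : nat) (W : set 'rV[Cx R]_m)
  (F : 'rV[Cx R]_m -> Cx R) : Prop :=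
  if n is n'.+1 then
    (forall z, W z -> differentiable (re_part F) (toR2 z) /\
                      differentiable (im_part F) (toR2 z)) /\
    (forall w, diff_upto n' W (rderiv w F))
  else True.

Definition Csmooth (R : realType) (m : nat) (W : set 'rV[Cx R]_m)
  (F : 'rV[Cx R]_m -> Cx R) : Prop := forall n, diff_upto n W F.

(* Holomorphic: smooth solution of the Cauchy-Riemann equations. *)
Definition Cholo (R : realType) (m : nat) (W : set 'rV[Cx R]_m)
  (F : 'rV[Cx R]_m -> Cx R) : Prop :=
  Csmooth W F /\ forall k z, W z -> dzbar k F z = 0.

Definition Cholo_map (R : realType) (m : nat) (W : set 'rV[Cx R]_m)
  (G : 'rV[Cx R]_m -> 'rV[Cx R]_m) : Prop :=
  forall l, Cholo W (fun z => G z 0 l).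

(* [u] is a homeomorphism, with inverse [v], from the open set [U] onto an open
   subset of C^m. Values outside [U] and [u @` U] are irrelevant. *)
Record is_chart (R : realType) (m : nat) (M : topologicalType) (U : set M)
  (u : M -> 'rV[Cx R]_m) (v : 'rV[Cx R]_m -> M) : Prop := IsChart {
  chart_open : open U;
  chart_open_image : open (u @` U);
  chart_cancel : forall p, U p -> v (u p) = p;
  chart_cont : forall p, U p -> {for p, continuous u};
  chart_inv_cont : forall z, (u @` U) z -> {for z, continuous v} }.

(* [man_at p] is a preferred chart around [p]; it only serves to represent
   tangent vectors at [p], see below. *)
Record complex_manifold (R : realType) (m : nat) := ComplexManifold {
  man_space :> topologicalType;
  man_hausdorff : hausdorff_space man_space;
  man_countable : @second_countable man_space;
  man_atlas : Type;
  man_dom : man_atlas -> set man_space;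
  man_chart : man_atlas -> man_space -> 'rV[Cx R]_m;
  man_inv : man_atlas -> 'rV[Cx R]_m -> man_space;
  man_chartP : forall i, is_chart (man_dom i) (man_chart i) (man_inv i);
  man_trans : forall i j,
    Cholo_map (man_chart i @` (man_dom i `&` man_dom j))
              (man_chart j \o man_inv i);
  man_at : man_space -> man_atlas;
  man_at_dom : forall p, man_dom (man_at p) p }.

Definition smooth_fun (R : realType) (m : nat) (M : complex_manifold R m)
  (U : set M) (f : M -> Cx R) : Prop :=
  forall i, Csmooth (man_chart i @` (U `&` man_dom i)) (f \o man_inv i).

Definition holo_fun (R : realType) (m : nat) (M : complex_manifold R m)
  (U : set M) (f : M -> Cx R) : Prop :=
  forall i, Cholo (man_chart i @` (U `&` man_dom i)) (f \o man_inv i).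

(* [u] is a system of local holomorphic coordinates on the open set [U], i.e. a
   chart belonging to the maximal holomorphic atlas. *)
Definition local_coords (R : realType) (m : nat) (M : complex_manifold R m)
  (U : set M) (u : M -> 'rV[Cx R]_m) : Prop :=
  exists v, is_chart U u v /\
    forall i, Cholo_map (man_chart i @` (U `&` man_dom i)) (u \o man_inv i) /\
              Cholo_map (u @` (U `&` man_dom i)) (man_chart i \o v).

(* A vector of the fibre of T^(1,0) at [p] is represented by the row of its
   components in the chart [man_at p]. *)
Definition vfield (R : realType) (m : nat) (M : complex_manifold R m) : Type :=
  M -> 'rV[Cx R]_m.

(* v(f) and vbar(f), for v in T^(1,0)_p *)
Definition vder (R : realType) (m : nat) (M : complex_manifold R m) (p : M)
  (v : 'rV[Cx R]_m) (f : M -> Cx R) : Cx R :=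
  \sum_k v 0 k * dz k (f \o man_inv (man_at p)) (man_chart (man_at p) p).

Definition vbarder (R : realType) (m : nat) (M : complex_manifold R m) (p : M)
  (v : 'rV[Cx R]_m) (f : M -> Cx R) : Cx R :=
  \sum_k (v 0 k)^* * dzbar k (f \o man_inv (man_at p)) (man_chart (man_at p) p).

(* The components in the chart [i] of a tangent vector at [p] in [man_dom i]:
   the derivatives along [v] of the coordinate functions of that chart. *)
Definition vcomp (R : realType) (m : nat) (M : complex_manifold R m)
  (i : man_atlas M) (p : M) (v : 'rV[Cx R]_m) : 'rV[Cx R]_m :=
  \row_l vder p v (fun q => man_chart i q 0 l).

Definition smooth_field (R : realType) (m : nat) (M : complex_manifold R m)
  (U : set M) (X : vfield M) : Prop :=
  forall i l, smooth_fun (U `&` man_dom i) (fun q => vcomp i q (X q) 0 l).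

Definition holo_field (R : realType) (m : nat) (M : complex_manifold R m)
  (U : set M) (X : vfield M) : Prop :=
  forall i l, holo_fun (U `&` man_dom i) (fun q => vcomp i q (X q) 0 l).

(* Bracket of (1,0)-vector fields,
     [X, Y]^l = X(Y^l) - Y(X^l)
   in the chart around the point. Also gives L_X Y, for X holomorphic. *)
Definition bracket (R : realType) (m : nat) (M : complex_manifold R m)
  (X Y : vfield M) : vfield M := fun p =>
  \row_l (vder p (X p) (fun q => vcomp (man_at p) q (Y q) 0 l)
          - vder p (Y p) (fun q => vcomp (man_at p) q (X q) 0 l)).

(* d/du^a, the vector field dual to du^1, ..., du^m *)
Definition coord_field (R : realType) (m : nat) (M : complex_manifold R m)
  (u : M -> 'rV[Cx R]_m) (a : 'I_m) : vfield M := fun q =>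
  row a (invmx (\matrix_(k, l) vder q (delta_mx 0 k) (fun p => u p 0 l))).

(* [D p v a] stands for the derivative at [p] of the section [a]: along [v] for
   (1,0)-operators and along [vbar] for (0,1)-operators. Only its values on
   sections that are smooth near [p] are meaningful. *)
Definition operator (R : realType) (m : nat) (M : complex_manifold R m)
  : Type := forall p : M, 'rV[Cx R]_m -> vfield M -> 'rV[Cx R]_m.

Definition along (R : realType) (m : nat) (M : complex_manifold R m)
  (D : operator M) (X a : vfield M) : vfield M := fun p => D p (X p) a.

Record connection10 (R : realType) (m : nat) (M : complex_manifold R m)
  (D : operator M) : Prop := Connection10 {
  conn_local : forall (U : set M) a b p v, open U -> U p ->
    smooth_field U a -> smooth_field U b -> (forall q, U q -> a q = b q) ->
    D p v a = D p v b;
  conn_linear : forall (U : set M) a p k v w, open U -> U p ->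
    smooth_field U a -> D p (k *: v + w) a = k *: D p v a + D p w a;
  conn_add : forall (U : set M) a b p v, open U -> U p ->
    smooth_field U a -> smooth_field U b ->
    D p v (fun q => a q + b q) = D p v a + D p v b;
  conn_leibniz : forall (U : set M) f a p v, open U -> U p ->
    smooth_fun U f -> smooth_field U a ->
    D p v (fun q => f q *: a q) = vder p v f *: a p + f p *: D p v a;
  conn_smooth : forall (U : set M) X a, open U ->
    smooth_field U X -> smooth_field U a -> smooth_field U (along D X a) }.

(* A holomorphic connection on the holomorphic tangent bundle, identified with
   its extension to a (1,0)-connection on smooth sections of T^(1,0). *)
Record holo_connection (R : realType) (m : nat) (M : complex_manifold R m)
  (D : operator M) : Prop := HoloConnection {
  hconn_10 : connection10 D;
  hconn_holo : forall (U : set M) X Y, open U ->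
    holo_field U X -> holo_field U Y -> holo_field U (along D X Y) }.

Definition eq_connection (R : realType) (m : nat) (M : complex_manifold R m)
  (D1 D2 : operator M) : Prop :=
  forall (U : set M) a p v, open U -> U p -> smooth_field U a ->
    D1 p v a = D2 p v a.

Definition dbar (R : realType) (m : nat) (M : complex_manifold R m)
  : operator M := fun p v a =>
  \row_l vbarder p v (fun q => vcomp (man_at p) q (a q) 0 l).

Record levi_civita (R : realType) (m : nat) (M : complex_manifold R m)
  (g : M -> 'rV[Cx R]_m -> 'rV[Cx R]_m -> Cx R) (nabla : operator M)
  : Prop := LeviCivita {
  lc_connection : holo_connection nabla;
  lc_torsion : forall (U : set M) X Y p, open U -> U p ->
    holo_field U X -> holo_field U Y ->
    nabla p (X p) Y - nabla p (Y p) X = bracket X Y p;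
  lc_metric : forall (U : set M) X Y p v, open U -> U p ->
    holo_field U X -> holo_field U Y ->
    vder p v (fun q => g q (X q) (Y q)) =
      g p (nabla p v X) (Y p) + g p (X p) (nabla p v Y) }.

(* [D'] is the (1,0)-part of the Chern connection of [h]: D' + dbar is
   compatible with the sesquilinear form [h]. *)
Record chern (R : realType) (m : nat) (M : complex_manifold R m)
  (h : M -> 'rV[Cx R]_m -> 'rV[Cx R]_m -> Cx R) (D' : operator M)
  : Prop := Chern {
  chern_10 : connection10 D';
  chern_metric : forall (U : set M) a b p v, open U -> U p ->
    smooth_field U a -> smooth_field U b ->
    vder p v (fun q => h q (a q) (b q)) =
      h p (D' p v a) (b p) + h p (a p) (dbar p v b);
  chern_metric_bar : forall (U : set M) a b p v, open U -> U p ->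
    smooth_field U a -> smooth_field U b ->
    vbarder p v (fun q => h q (a q) (b q)) =
      h p (dbar p v a) (b p) + h p (a p) (D' p v b) }.

(* (nabla_Z c)(X, Y, W) for c(X, Y, W) = g(X o Y, W) *)
Definition nabla_c (R : realType) (m : nat) (M : complex_manifold R m)
  (g : M -> 'rV[Cx R]_m -> 'rV[Cx R]_m -> Cx R)
  (mul : M -> 'rV[Cx R]_m -> 'rV[Cx R]_m -> 'rV[Cx R]_m)
  (nabla : operator M) (Z X Y W : vfield M) (p : M) : Cx R :=
  let c q x y w := g q (mul q x y) w in
  vder p (Z p) (fun q => c q (X q) (Y q) (W q))
  - c p (nabla p (Z p) X) (Y p) (W p)
  - c p (X p) (nabla p (Z p) Y) (W p)
  - c p (X p) (Y p) (nabla p (Z p) W).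

Record frobenius (R : realType) (m : nat) (M : complex_manifold R m)
  (g : M -> 'rV[Cx R]_m -> 'rV[Cx R]_m -> Cx R) (nabla : operator M)
  (mul : M -> 'rV[Cx R]_m -> 'rV[Cx R]_m -> 'rV[Cx R]_m)
  (e E : vfield M) (d : Cx R) : Prop := Frobenius {
  frob_g_linear : forall p k x y z,
    g p (k *: x + y) z = k * g p x z + g p y z;
  frob_g_sym : forall p x y, g p x y = g p y x;
  frob_g_nondeg : forall p x, (forall y, g p x y = 0) -> x = 0;
  frob_g_holo : forall (U : set M) X Y, open U ->
    holo_field U X -> holo_field U Y ->
    holo_fun U (fun q => g q (X q) (Y q));
  frob_mul_linear : forall p k x y z,
    mul p (k *: x + y) z = k *: mul p x z + mul p y z;
  frob_mulC : forall p x y, mul p x y = mul p y x;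
  frob_mulA : forall p x y z, mul p x (mul p y z) = mul p (mul p x y) z;
  frob_mul_holo : forall (U : set M) X Y, open U ->
    holo_field U X -> holo_field U Y ->
    holo_field U (fun q => mul q (X q) (Y q));
  frob_unit_holo : holo_field setT e;
  frob_mul1 : forall p x, mul p (e p) x = x;
  frob_euler_holo : holo_field setT E;
  frob_levi_civita : levi_civita g nabla;
  frob_flat : forall (U : set M) X Y Z p, open U -> U p ->
    holo_field U X -> holo_field U Y -> holo_field U Z ->
    nabla p (X p) (along nabla Y Z) - nabla p (Y p) (along nabla X Z)
    - nabla p (bracket X Y p) Z = 0;
  frob_invariant : forall p x y z, g p (mul p x y) z = g p x (mul p y z);
  frob_unit_flat : forall p v, nabla p v e = 0;
  frob_nabla_c : forall (U : set M) X Y Z W p, open U -> U p ->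
    holo_field U X -> holo_field U Y -> holo_field U Z -> holo_field U W ->
    [/\ nabla_c g mul nabla Z X Y W p = nabla_c g mul nabla X Z Y W p,
        nabla_c g mul nabla Z X Y W p = nabla_c g mul nabla Z Y X W p &
        nabla_c g mul nabla Z X Y W p = nabla_c g mul nabla Z X W Y p];
  frob_euler_flat : forall (U : set M) X Y p, open U -> U p ->
    holo_field U X -> holo_field U Y ->
    nabla p (X p) (along nabla Y E) - nabla p (nabla p (X p) Y) E = 0;
  frob_euler_mul : forall (U : set M) X Y p, open U -> U p ->
    holo_field U X -> holo_field U Y ->
    bracket E (fun q => mul q (X q) (Y q)) p
    - mul p (bracket E X p) (Y p) - mul p (X p) (bracket E Y p)
    = mul p (X p) (Y p);
  frob_euler_g : forall (U : set M) X Y p, open U -> U p ->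
    holo_field U X -> holo_field U Y ->
    vder p (E p) (fun q => g q (X q) (Y q))
    - g p (bracket E X p) (Y p) - g p (X p) (bracket E Y p)
    = (2 - d) * g p (X p) (Y p) }.

Definition semisimple (R : realType) (m : nat) (M : complex_manifold R m)
  (mul : M -> 'rV[Cx R]_m -> 'rV[Cx R]_m -> 'rV[Cx R]_m) : Prop :=
  forall p : M, exists U u, [/\ U p, local_coords U u &
    forall q a b, U q ->
      mul q (coord_field u a q) (coord_field u b q) =
        if a == b then coord_field u a q else 0].

Definition flat_coords (R : realType) (m : nat) (M : complex_manifold R m)
  (nabla : operator M) (U : set M) (t : M -> 'rV[Cx R]_m) : Prop :=
  local_coords U t /\
  forall i q v, U q -> nabla q v (coord_field t i) = 0.

Definition potential (R : realType) (m : nat) (M : complex_manifold R m)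
  (g : M -> 'rV[Cx R]_m -> 'rV[Cx R]_m -> Cx R)
  (mul : M -> 'rV[Cx R]_m -> 'rV[Cx R]_m -> 'rV[Cx R]_m)
  (U : set M) (t : M -> 'rV[Cx R]_m) (F : M -> Cx R) : Prop :=
  let d_ i f := fun q => vder q (coord_field t i q) f in
  holo_fun U F /\
  forall i j k q, U q ->
    d_ i (d_ j (d_ k F)) q =
      g q (mul q (coord_field t i q) (coord_field t j q)) (coord_field t k q).

(* [msize P] is 1 + the total degree of [P]. A bound on the degree is the
   same as degree exactly three, except for m = 0: the unit e is non-zero when
   m > 0, so that the third derivatives of F do not all vanish. *)
Definition trivial (R : realType) (m : nat) (M : complex_manifold R m)
  (g : M -> 'rV[Cx R]_m -> 'rV[Cx R]_m -> Cx R) (nabla : operator M)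
  (mul : M -> 'rV[Cx R]_m -> 'rV[Cx R]_m -> 'rV[Cx R]_m) : Prop :=
  forall p : M, exists U t (P : mpoly m (Cx R)),
    [/\ U p, flat_coords nabla U t, (msize P <= 4)%N &
        potential g mul U t (fun q => meval (fun i => t q 0 i) P)].

(* [D''], [Ct] take [v] for the (0,1)-vector vbar. Forms are evaluated on local
   holomorphic vector fields X, Y, for which [X, Ybar] = 0; the square of
   C + D'' (resp. Ct + D') is decomposed into its (2,0), (1,1), (0,2) parts. *)
Record cv_structure (R : realType) (m : nat) (M : complex_manifold R m)
  (D' D'' : operator M)
  (C Ct : M -> 'rV[Cx R]_m -> 'rV[Cx R]_m -> 'rV[Cx R]_m)
  (kappa : M -> 'rV[Cx R]_m -> 'rV[Cx R]_m)
  (h : M -> 'rV[Cx R]_m -> 'rV[Cx R]_m -> Cx R)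
  (calU : M -> 'rV[Cx R]_m -> 'rV[Cx R]_m) (Q : vfield M -> vfield M)
  : Prop := CVStructure {
  (* (C + D'')^2 = 0 *)
  cv_CC : forall p x y a, C p x (C p y a) - C p y (C p x a) = 0;
  cv_D''C : forall (U : set M) X Y a p, open U -> U p ->
    holo_field U X -> holo_field U Y -> smooth_field U a ->
    D'' p (X p) (fun q => C q (Y q) (a q)) - C p (Y p) (D'' p (X p) a) = 0;
  cv_D''D'' : forall (U : set M) X Y a p, open U -> U p ->
    holo_field U X -> holo_field U Y -> smooth_field U a ->
    D'' p (X p) (along D'' Y a) - D'' p (Y p) (along D'' X a)
    - D'' p (bracket X Y p) a = 0;
  (* (Ct + D')^2 = 0 *)
  cv_CtCt : forall p x y a, Ct p x (Ct p y a) - Ct p y (Ct p x a) = 0;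
  cv_D'Ct : forall (U : set M) X Y a p, open U -> U p ->
    holo_field U X -> holo_field U Y -> smooth_field U a ->
    D' p (X p) (fun q => Ct q (Y q) (a q)) - Ct p (Y p) (D' p (X p) a) = 0;
  cv_D'D' : forall (U : set M) X Y a p, open U -> U p ->
    holo_field U X -> holo_field U Y -> smooth_field U a ->
    D' p (X p) (along D' Y a) - D' p (Y p) (along D' X a)
    - D' p (bracket X Y p) a = 0;
  (* D'(C) = 0 *)
  cv_D'C : forall (U : set M) X Y a p, open U -> U p ->
    holo_field U X -> holo_field U Y -> smooth_field U a ->
    (D' p (X p) (fun q => C q (Y q) (a q)) - C p (Y p) (D' p (X p) a))
    - (D' p (Y p) (fun q => C q (X q) (a q)) - C p (X p) (D' p (Y p) a))
    - C p (bracket X Y p) (a p) = 0;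
  (* D''(Ct) = 0 *)
  cv_D''Ct : forall (U : set M) X Y a p, open U -> U p ->
    holo_field U X -> holo_field U Y -> smooth_field U a ->
    (D'' p (X p) (fun q => Ct q (Y q) (a q)) - Ct p (Y p) (D'' p (X p) a))
    - (D'' p (Y p) (fun q => Ct q (X q) (a q)) - Ct p (X p) (D'' p (Y p) a))
    - Ct p (bracket X Y p) (a p) = 0;
  (* D'D'' + D''D' = - (C Ct + Ct C), evaluated on (X, Ybar) *)
  cv_D'D'' : forall (U : set M) X Y a p, open U -> U p ->
    holo_field U X -> holo_field U Y -> smooth_field U a ->
    D' p (X p) (along D'' Y a) - D'' p (Y p) (along D' X a) =
    - (C p (X p) (Ct p (Y p) (a p)) - Ct p (Y p) (C p (X p) (a p)));

  cv_kappaK : forall p a, kappa p (kappa p a) = a;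
  cv_D'kappa : forall (U : set M) a p v, open U -> U p -> smooth_field U a ->
    D' p v (fun q => kappa q (a q)) = kappa p (D'' p v a);
  cv_D''kappa : forall (U : set M) a p v, open U -> U p -> smooth_field U a ->
    D'' p v (fun q => kappa q (a q)) = kappa p (D' p v a);
  cv_kappaC : forall p v a, kappa p (C p v (kappa p a)) = Ct p v a;

  cv_h_linear : forall p k a b c,
    h p (k *: a + b) c = k * h p a c + h p b c;
  cv_h_semilinear : forall p k a b c,
    h p a (k *: b + c) = k^* * h p a b + h p a c;
  cv_h_nondeg : forall p a, (forall b, h p a b = 0) -> a = 0;
  cv_h_herm : forall p a b, h p b a = (h p a b)^*;
  cv_h_real : forall p a b,
    kappa p a = a -> kappa p b = b -> h p a b \is Num.real;
  cv_h_C : forall p v a b, h p (C p v a) b = h p a (Ct p v b);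
  cv_D'h : forall (U : set M) a b p v, open U -> U p ->
    smooth_field U a -> smooth_field U b ->
    vder p v (fun q => h q (a q) (b q)) =
      h p (D' p v a) (b p) + h p (a p) (D'' p v b);
  cv_D''h : forall (U : set M) a b p v, open U -> U p ->
    smooth_field U a -> smooth_field U b ->
    vbarder p v (fun q => h q (a q) (b q)) =
      h p (D'' p v a) (b p) + h p (a p) (D' p v b);

  cv_CU : forall p v a, C p v (calU p a) - calU p (C p v a) = 0;
  cv_D'U : forall (U : set M) X a p, open U -> U p ->
    holo_field U X -> smooth_field U a ->
    (D' p (X p) (fun q => calU q (a q)) - calU p (D' p (X p) a))
    - (C p (X p) (Q a p) - Q (fun q => C q (X q) (a q)) p)
    + C p (X p) (a p) = 0;
  cv_D''U : forall (U : set M) a p v, open U -> U p -> smooth_field U a ->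
    D'' p v (fun q => calU q (a q)) - calU p (D'' p v a) = 0;
  cv_D'Q : forall (U : set M) X a p, open U -> U p ->
    holo_field U X -> smooth_field U a ->
    let kUk x := kappa p (calU p (kappa p x)) in
    (D' p (X p) (Q a) - Q (along D' X a) p)
    + (C p (X p) (kUk (a p)) - kUk (C p (X p) (a p))) = 0;
  cv_kappaQ : forall (U : set M) a p, open U -> U p -> smooth_field U a ->
    kappa p (Q (fun q => kappa q (a q)) p) + Q a p = 0;
  cv_h_U : forall p a b,
    h p (calU p a) b = h p a (kappa p (calU p (kappa p b)));
  cv_h_Q : forall (U : set M) a b p, open U -> U p ->
    smooth_field U a -> smooth_field U b ->
    h p (Q a p) (b p) = h p (a p) (Q b p) }.

Definition cdv_h (R : realType) (m : nat) (M : complex_manifold R m)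
  (g : M -> 'rV[Cx R]_m -> 'rV[Cx R]_m -> Cx R)
  (kappa : M -> 'rV[Cx R]_m -> 'rV[Cx R]_m)
  : M -> 'rV[Cx R]_m -> 'rV[Cx R]_m -> Cx R :=
  fun p a b => g p a (kappa p b).

(* [nabla] is the Levi-Civita connection of [g] and [D'] the (1,0)-part of the
   Chern connection of h; both are determined by (M, g, kappa). *)
Record cdv_structure (R : realType) (m : nat) (M : complex_manifold R m)
  (g : M -> 'rV[Cx R]_m -> 'rV[Cx R]_m -> Cx R)
  (mul : M -> 'rV[Cx R]_m -> 'rV[Cx R]_m -> 'rV[Cx R]_m)
  (e E : vfield M) (d : Cx R)
  (kappa : M -> 'rV[Cx R]_m -> 'rV[Cx R]_m)
  (nabla D' : operator M) : Prop := CDVStructure {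
  cdv_frobenius : frobenius g nabla mul e E d;
  cdv_kappa_antilinear : forall p k x y,
    kappa p (k *: x + y) = k^* *: kappa p x + kappa p y;
  cdv_kappaK : forall p x, kappa p (kappa p x) = x;
  cdv_kappa_smooth : forall (U : set M) a, open U ->
    smooth_field U a -> smooth_field U (fun q => kappa q (a q));
  cdv_chern : chern (cdv_h g kappa) D';
  cdv_d_real : d \is Num.real;
  cdv_unit : forall p, D' p (e p) e = 0;
  cdv_cv :
    let C p x y := - mul p x y in
    let Ct p x y := kappa p (C p x (kappa p y)) in
    let calU p x := mul p (E p) x in
    let Q a p := D' p (E p) a - bracket E a p - ((2 - d) / 2) *: a p in
    cv_structure D' (@dbar R m M) C Ct kappa (cdv_h g kappa) calU Q }.

(* Main.v *)
Require Import Defs.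
From HB Require Import structures.
From mathcomp Require Import all_boot all_order all_algebra.
From mathcomp Require Import all_classical all_reals all_analysis.
From mathcomp Require Import complex.
From mathcomp Require Import ring lra.
From mathcomp Require Import -(notations) mpoly.
Set Implicit Arguments.
Unset Strict Implicit.
Unset Printing Implicit Defensive.
Import Order.TTheory GRing.Theory Num.Theory.
Import numFieldNormedType.Exports.
Local Open Scope classical_set_scope.
Local Open Scope ring_scope.

(** If nabla is the (1,0)-part D' of the Chern connection, then the unit field e
    is flat for D', besides being holomorphic. Applied to e, the equation
    D'D'' + D''D' = - (C Ct + Ct C) therefore loses its left-hand side. What
    remains says that every operator kappa (y o kappa _) is the multiplication
    by the vector w_y = kappa (y o kappa e) (lemmas [w_mul_e] and [wE]). Hence
    y |-> w_y is an antilinear endomorphism of the algebra (T_q, o), injective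
    because kappa is bijective and o has a unit.

    Let e_1, ..., e_m be the idempotent fields d/du^a of canonical coordinates
    u. Their images w_b are idempotent, so that the components s_ba of w_b in
    the frame (e_a) are smooth functions with s_ba^2 = s_ba; the derivatives of
    such functions vanish ([vder_s]). On the other hand the equation
    D'(Ct) = 0, applied to e, says that the w_b are D'-flat ([w_flat]). So
    sum_a s_ba D' e_a = 0, where the matrix s is invertible, and the e_a are
    D'-flat, hence nabla-flat ([canonical_flat]).

    Thus canonical coordinates are flat. As nabla preserves g, the functions
    g(e_a, e_a) are locally constant, and the third derivatives
    g(e_i o e_j, e_k) of a potential are g(e_k, e_k) if i = j = k and 0
    otherwise. They are those of the cubic polynomial
    sum_a g(e_a, e_a) (u^a)^3 / 6: the structure is trivial
    ([canonical_cubic_potential]).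

    These computations rest on elementary calculus in several complex
    variables. Derivatives are real ones and tangent vectors are represented in
    a chart that depends on the point, so that the chain rule for Wirtinger
    derivatives is used throughout ([dz_comp], [vder_coords]). That the fields
    e_a are holomorphic requires the derivatives of a holomorphic function to
    be holomorphic ([Cholo_dz]), which follows from the symmetry of second
    derivatives ([schwarz]). *)

(** * Real and Wirtinger derivatives at a point of C^m *)

Section PointCalculus.
Variables (R : realType) (m : nat).
Local Notation C := (Cx R).
Local Notation V := ('rV[C]_m).
Local Notation W2 := ('rV[R]_m * 'rV[R]_m)%type.
Implicit Types (F G : V -> C) (z : V) (w : W2).

Lemma cx_eq (x y : C) :
  complex.Re x = complex.Re y -> complex.Im x = complex.Im y -> x = y.
Proof. by case: x => a b; case: y => c d /= -> ->. Qed.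

Lemma reD (x y : C) : complex.Re (x + y) = complex.Re x + complex.Re y.
Proof. by case: x; case: y. Qed.
Lemma imD (x y : C) : complex.Im (x + y) = complex.Im x + complex.Im y.
Proof. by case: x; case: y. Qed.
Lemma reM (x y : C) : complex.Re (x * y) =
  complex.Re x * complex.Re y - complex.Im x * complex.Im y.
Proof. by case: x; case: y. Qed.
Lemma imM (x y : C) : complex.Im (x * y) =
  complex.Re x * complex.Im y + complex.Im x * complex.Re y.
Proof. by case: x; case: y. Qed.
Lemma conjE (x : C) : x^* = (complex.Re x -i* complex.Im x)%C.
Proof. by case: x. Qed.

Lemma ofR2K w : toR2 (ofR2 w) = w.
Proof. by case: w => x y; congr pair; apply/rowP => k; rewrite !mxE. Qed.

Lemma toR2K z : ofR2 (toR2 z) = z.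
Proof. by apply/rowP => k; rewrite !mxE; apply: cx_eq. Qed.

(** The directional derivatives [rderiv] are defined for every function; the
    rules that they obey hold under this assumption. *)
Definition rdiff F z :=
  differentiable (re_part F) (toR2 z) /\ differentiable (im_part F) (toR2 z).

Lemma rderivE w F z : rdiff F z -> rderiv w F z =
  ('d (re_part F) (toR2 z) w +i* 'd (im_part F) (toR2 z) w)%C.
Proof. by case=> dre dim; rewrite /rderiv !deriveE. Qed.

Lemma rdiff_cst (c : C) z : rdiff (fun=> c) z.
Proof. by split; apply: differentiable_cst. Qed.

Lemma rderiv_cst w (c : C) z : rderiv w (fun=> c) z = 0.
Proof. by apply: cx_eq; rewrite /= derive_cst. Qed.

Lemma re_partD F G : re_part (fun x => F x + G x) = re_part F + re_part G.
Proof. by apply/funext => x; rewrite /re_part reD. Qed.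

Lemma im_partD F G : im_part (fun x => F x + G x) = im_part F + im_part G.
Proof. by apply/funext => x; rewrite /im_part imD. Qed.

Lemma rdiffD F G z : rdiff F z -> rdiff G z -> rdiff (fun x => F x + G x) z.
Proof.
move=> [a b] [c d]; rewrite /rdiff re_partD im_partD.
by split; exact: differentiableD.
Qed.

Lemma rderivD w F G z : rdiff F z -> rdiff G z ->
  rderiv w (fun x => F x + G x) z = rderiv w F z + rderiv w G z.
Proof.
move=> [a b] [c d]; rewrite /rderiv re_partD im_partD !deriveD //;
  exact: diff_derivable.
Qed.

Lemma re_partM F G : re_part (fun x => F x * G x) =
  re_part F * re_part G - im_part F * im_part G.
Proof. by apply/funext => x; rewrite /re_part reM. Qed.

Lemma im_partM F G : im_part (fun x => F x * G x) =
  re_part F * im_part G + im_part F * re_part G.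
Proof. by apply/funext => x; rewrite /im_part imM. Qed.

Lemma rdiffM F G z : rdiff F z -> rdiff G z -> rdiff (fun x => F x * G x) z.
Proof.
move=> [a b] [c d]; split.
- rewrite re_partM; apply: differentiableB; exact: differentiableM.
- rewrite im_partM; apply: differentiableD; exact: differentiableM.
Qed.

Lemma rderivM w F G z : rdiff F z -> rdiff G z ->
  rderiv w (fun x => F x * G x) z = rderiv w F z * G z + F z * rderiv w G z.
Proof.
move=> [a b] [c d].
have e1 : F z = (re_part F (toR2 z) +i* im_part F (toR2 z))%C.
  by apply: cx_eq; rewrite /re_part /im_part toR2K.
have e2 : G z = (re_part G (toR2 z) +i* im_part G (toR2 z))%C.
  by apply: cx_eq; rewrite /re_part /im_part toR2K.
have da := diff_derivable (v := w) a; have db := diff_derivable (v := w) b.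
have dc := diff_derivable (v := w) c; have dd := diff_derivable (v := w) d.
rewrite e1 e2 /rderiv; apply: cx_eq.
- rewrite reD !reM /= re_partM (deriveB (derivableM da dc) (derivableM db dd)).
  rewrite (deriveM da dc) (deriveM db dd).
  move: ('D_w (re_part F) _) ('D_w (re_part G) _) => f g.
  move: ('D_w (im_part F) _) ('D_w (im_part G) _) => f' g'.
  by rewrite /GRing.scale /=; ring.
- rewrite imD !imM /= im_partM (deriveD (derivableM da dd) (derivableM db dc)).
  rewrite (deriveM da dd) (deriveM db dc).
  move: ('D_w (re_part F) _) ('D_w (re_part G) _) => f g.
  move: ('D_w (im_part F) _) ('D_w (im_part G) _) => f' g'.
  by rewrite /GRing.scale /=; ring.
Qed.

Lemma rdiff_sum (I : Type) (r : seq I) (P : pred I) (F : I -> V -> C) z :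
  (forall i, P i -> rdiff (F i) z) ->
  rdiff (fun x => \sum_(i <- r | P i) F i x) z.
Proof.
move=> dF; elim: r => [|i r IH].
  rewrite (_ : (fun x : V => \sum_(i <- [::] | P i) F i x) = fun=> 0); first exact: rdiff_cst.
  by apply/funext => x; rewrite big_nil.
rewrite (_ : (fun x : V => \sum_(j <- i :: r | P j) F j x) = fun x => if P i
    then F i x + \sum_(j <- r | P j) F j x else \sum_(j <- r | P j) F j x).
  2: by apply/funext => x; rewrite big_cons.
by case: (boolP (P i)) => Pi //; apply: rdiffD => //; exact: dF.
Qed.

Lemma rderiv_sum (I : Type) (r : seq I) (P : pred I) (F : I -> V -> C) w z :
  (forall i, P i -> rdiff (F i) z) ->
  rderiv w (fun x => \sum_(i <- r | P i) F i x) z =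
  \sum_(i <- r | P i) rderiv w (F i) z.
Proof.
move=> dF; elim: r => [|i r IH].
  rewrite big_nil (_ : (fun x : V => \sum_(i <- [::] | P i) F i x) = fun=> 0); first exact: rderiv_cst.
  by apply/funext => x; rewrite big_nil.
rewrite (_ : (fun x : V => \sum_(j <- i :: r | P j) F j x) = fun x => if P i
    then F i x + \sum_(j <- r | P j) F j x else \sum_(j <- r | P j) F j x).
  2: by apply/funext => x; rewrite big_cons.
rewrite big_cons; case: (boolP (P i)) => Pi //.
by rewrite rderivD ?IH //; [exact: dF | exact: rdiff_sum].
Qed.

Lemma cx_norm_lt (x : C) (e : R) :
  `|complex.Re x| < e / 2 -> `|complex.Im x| < e / 2 -> `|x| < (e%:C)%C.
Proof.
move=> hr hi; rewrite (complexE x); apply: (le_lt_trans (ler_normD _ _)).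
have nR (a : R) : `|(a%:C)%C : C| = (`|a|%:C)%C.
  by rewrite normc_def /= expr0n addr0 sqrtr_sqr.
have ni : `|'i%C : C| = 1 by rewrite normc_def /= expr0n expr1n add0r sqrtr1.
rewrite normrM ni mul1r !nR ltcE /= addr0 eqxx /=; lra.
Qed.

(** Derivatives are taken in R^m x R^m while charts are open for the C-valued
    norm of C^m. A ball of half the radius for the real and the imaginary parts
    fits into the complex ball. *)
Lemma ofR2_near (O : set V) z : nbhs z O ->
  \forall w \near toR2 z, O (ofR2 w).
Proof.
move=> /nbhs_ballP[e /= e0 sO].
have [ei er] : complex.Im e = 0 /\ 0 < complex.Re e.
  by move: e0; rewrite ltcE /= => /andP[/eqP ->].
have er2 : 0 < complex.Re e / 2 by lra.
apply/nbhs_ballP; exists (complex.Re e / 2) => //= w [[_ h1] [_ h2]].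
apply: sO; split=> // i j; rewrite ord1.
rewrite /ball /= (_ : e = ((complex.Re e)%:C)%C); last exact: cx_eq.
move: (h1 0 j) (h2 0 j); rewrite /ball /= !mxE => {}h1 {}h2.
apply: cx_norm_lt.
  by move: h1; case: (z 0 j).
by move: h2; case: (z 0 j).
Qed.

(** The first-order expansion of f at x is also one of g. *)
Lemma near_differentiable (U' W' : normedModType R) (f g : U' -> W') x :
  (\near x, f x = g x) -> differentiable f x -> differentiable g x.
Proof.
move=> fg df; have fgx := nbhs_singleton fg.
have h : g \o shift x = cst (g x) + 'd f x +o_ 0 id.
  have [_ /eqaddoP h] := (diff_locallyP _ _).1 df.
  have fg0 : \forall y \near (0 : U'), f (y + x) = g (y + x).
    by move: fg; rewrite (near_shift 0 x) /= subr0.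
  apply/eqaddoP => e e0; near=> y.
  have <- : (f \o shift x - (cst (f x) + 'd f x)) y =
         (g \o shift x - (cst (g x) + 'd f x)) y.
    rewrite /GRing.add /= /GRing.opp /= /GRing.add /= /cst fgx; congr (_ + _).
    by near: y; exact: fg0.
  by near: y; exact: h.
have cd := diff_continuous df.
by apply/diff_locallyP; rewrite (diff_unique cd h).
Unshelve. all: by end_near. Qed.

Lemma near_rdiff F G z : (\near z, F z = G z) -> rdiff F z -> rdiff G z.
Proof.
move=> /ofR2_near FG [a b]; split; [move: a|move: b];
  apply: near_differentiable; apply: filterS FG => w.
- by rewrite /re_part => ->.
- by rewrite /im_part => ->.
Qed.

Lemma near_rderiv F G z w : (\near z, F z = G z) -> rderiv w F z = rderiv w G z.
Proof.
move=> /ofR2_near FG; rewrite /rderiv; congr Complex; apply: near_eq_derive;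
  by apply: filterS FG => v; rewrite /re_part /im_part => ->.
Qed.

Lemma near_dz F G z k : (\near z, F z = G z) -> dz k F z = dz k G z.
Proof. by move=> FG; rewrite /dz !(near_rderiv _ FG). Qed.

Lemma near_dzbar F G z k : (\near z, F z = G z) -> dzbar k F z = dzbar k G z.
Proof. by move=> FG; rewrite /dzbar !(near_rderiv _ FG). Qed.

Lemma rderiv_lin F z (a : R) w w' : rdiff F z ->
  rderiv (a *: w + w') F z = (a%:C)%C * rderiv w F z + rderiv w' F z.
Proof.
move=> dF; rewrite !(rderivE _ dF).
have pack (f g : W2 -> R) : (f (a *: w + w') = a * f w + f w') ->
    (g (a *: w + w') = a * g w + g w') ->
    (f (a *: w + w') +i* g (a *: w + w'))%C =
    (a%:C)%C * (f w +i* g w)%C + (f w' +i* g w')%C :> C.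
  by move=> -> ->; apply: cx_eq; rewrite ?reD ?reM ?imD ?imM /=; ring.
by apply: pack; exact: linearP.
Qed.

Lemma rderiv0 F z : rdiff F z -> rderiv 0 F z = 0.
Proof.
move=> dF; have h := rderiv_lin 1 0 0 dF.
rewrite scaler0 add0r (_ : (1%:C)%C = 1 :> C) // mul1r in h.
by apply: (addrI (rderiv 0 F z)); rewrite addr0 -h.
Qed.

Lemma rderivZ F z (a : R) w : rdiff F z ->
  rderiv (a *: w) F z = (a%:C)%C * rderiv w F z.
Proof.
by move=> dF; have := rderiv_lin a w 0 dF; rewrite addr0 (rderiv0 dF) addr0.
Qed.

Lemma rderiv_basis F z w : rdiff F z -> rderiv w F z =
  \sum_k (((w.1 0 k)%:C)%C * rderiv (delta_mx 0 k, 0) F z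
          + ((w.2 0 k)%:C)%C * rderiv (0, delta_mx 0 k) F z).
Proof.
move=> dF; have sumP (r : seq 'I_m) (f : 'I_m -> W2) :
    rderiv (\sum_(k <- r) f k) F z = \sum_(k <- r) rderiv (f k) F z.
  elim: r => [|k r IH]; first by rewrite !big_nil rderiv0.
  rewrite !big_cons -[f k]scale1r rderiv_lin // IH scale1r.
  by rewrite (_ : (1%:C)%C = 1 :> C) // mul1r.
transitivity (rderiv (\sum_k (w.1 0 k *: (delta_mx 0 k, 0) +
     w.2 0 k *: (0, delta_mx 0 k))) F z).
  congr (rderiv _ F z); case: w => x y /=.
  rewrite big_split /=; have e1 : \sum_k x 0 k *: ((delta_mx 0 k, 0) : W2) = (x, 0).
    rewrite {2}(row_sum_delta x); elim/big_ind2 : _ => //.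
    + by move=> a b c d -> ->; congr pair; rewrite add0r.
    + by move=> k _; congr pair; rewrite scaler0.
  have e2 : \sum_k y 0 k *: ((0, delta_mx 0 k) : W2) = (0, y).
    rewrite {2}(row_sum_delta y); elim/big_ind2 : _ => //.
    + by move=> a b c d -> ->; congr pair; rewrite add0r.
    + by move=> k _; congr pair; rewrite scaler0.
  by rewrite e1 e2; congr pair; rewrite ?addr0 ?add0r.
rewrite sumP; apply: eq_bigr => k _.
by rewrite (rderiv_lin _ _ _ dF) (rderivZ _ _ dF).
Qed.

(** With zeta = x + i y, the identity
    zeta d/dz + conj(zeta) d/dzbar = x d/dx + y d/dy holds in each variable. *)
Lemma rderiv_wirtinger F z w : rdiff F z -> rderiv w F z =
  \sum_k (ofR2 w 0 k * dz k F z + (ofR2 w 0 k)^* * dzbar k F z).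
Proof.
move=> dF; rewrite (rderiv_basis w dF); apply: eq_bigr => k _.
rewrite mxE conjE /dz /dzbar /=.
move: (rderiv _ _ _) (rderiv _ _ _) => a b.
have half : 2^-1 = ((2^-1)%:C)%C :> C.
  by rewrite -[RHS]/(real_complex R _) fmorphV rmorph_nat.
move: (w.1 0 k) (w.2 0 k) => x y; rewrite half; case: a b => [a a'] [b b'].
by apply: cx_eq; rewrite /=; field.
Qed.

Lemma rderiv_coord w l z : rderiv w (fun x => x 0 l) z = ofR2 w 0 l.
Proof.
have e1 : re_part (fun x : V => x 0 l) = (fun x : 'rV[R]_m => x 0 l) \o fst.
  by apply/funext => x; rewrite /re_part /ofR2 /= mxE.
have e2 : im_part (fun x : V => x 0 l) = (fun x : 'rV[R]_m => x 0 l) \o snd.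
  by apply/funext => x; rewrite /im_part /ofR2 /= mxE.
have key (p : W2 -> 'rV[R]_m) t : linear p ->
    'D_w ((fun x : 'rV[R]_m => x 0 l) \o p) t = p w 0 l.
  move=> lp; apply: cvg_lim => //=.
  apply: cvg_near_cst; near=> h.
  have hn0 : h != 0 by near: h; exact: nbhs_dnbhs_neq.
  by rewrite lp !mxE addrK /GRing.scale /= mulKf.
by rewrite /rderiv e1 e2 !key //= mxE.
Unshelve. all: by end_near. Qed.

Lemma differentiable_row (U' : normedModType R) (f : 'I_m -> U' -> R) x :
  (forall k, differentiable (f k) x) ->
  differentiable (fun y => \row_k f k y) x.
Proof.
move=> df; rewrite (_ : (fun _ => _) =
    \sum_(k < m) fun y => f k y *: (delta_mx 0 k : 'rV[R]_m)).
  by apply: differentiable_sum => k; exact: differentiableZl.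
apply/funext => y; rewrite fct_sumE [LHS]row_sum_delta.
by apply: eq_bigr => k _; rewrite mxE.
Qed.

Lemma diff_row (U' : normedModType R) (f : 'I_m -> U' -> R) x v :
  (forall k, differentiable (f k) x) ->
  'd (fun y => \row_k f k y) x v = \row_k 'D_v (f k) x.
Proof.
move=> df; have dr := differentiable_row df.
rewrite -deriveE // derive_mx; last exact: diff_derivable.
apply/rowP => k; rewrite [LHS]mxE [RHS]mxE.
rewrite (_ : (fun t => (\row_k f k t) 0 k) = f k) //.
by apply/funext => y; rewrite mxE.
Qed.

(** Real chain rule, for the map G' of R^m x R^m that G becomes when real and
    imaginary parts are separated. *)
Lemma rderiv_comp F (G : V -> V) z w :
  rdiff F (G z) -> (forall l, rdiff (fun x => G x 0 l) z) ->
  rdiff (F \o G) z /\ rderiv w (F \o G) z =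
    rderiv (toR2 (\row_l rderiv w (fun x => G x 0 l) z)) F (G z).
Proof.
move=> dF dG.
pose G' t := (\row_k re_part (fun x => G x 0 k) t,
              \row_k im_part (fun x => G x 0 k) t).
have dG' : differentiable G' (toR2 z).
  by apply: differentiable_pair; apply: differentiable_row => k; case: (dG k).
have G'z : G' (toR2 z) = toR2 (G z).
  by rewrite /G' /toR2; congr pair; apply/rowP => k;
    rewrite !mxE /re_part /im_part toR2K.
have G'E t : ofR2 (G' t) = G (ofR2 t).
  by apply/rowP => k; rewrite !mxE; apply: cx_eq.
have e1 : re_part (F \o G) = re_part F \o G'.
  by apply/funext => t; rewrite /re_part /= G'E.
have e2 : im_part (F \o G) = im_part F \o G'.
  by apply/funext => t; rewrite /im_part /= G'E.
have dr : differentiable (re_part F) (G' (toR2 z)) by rewrite G'z; case: dF.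
have di : differentiable (im_part F) (G' (toR2 z)) by rewrite G'z; case: dF.
have dFG : rdiff (F \o G) z.
  have h1 := differentiable_comp dG' dr; have h2 := differentiable_comp dG' di.
  by rewrite /rdiff e1 e2; split.
have dre k : differentiable (re_part (fun x => G x 0 k)) (toR2 z) by case: (dG k).
have dim k : differentiable (im_part (fun x => G x 0 k)) (toR2 z) by case: (dG k).
have dw : 'd G' (toR2 z) w = toR2 (\row_l rderiv w (fun x => G x 0 l) z).
  apply: etrans (congr1 (fun h => h w)
    (diff_pair (differentiable_row dre) (differentiable_row dim))) _.
  apply: (f_equal2 pair).
  - apply: etrans (diff_row w dre) _.
    by apply/rowP => k; rewrite [LHS]mxE [RHS]mxE mxE.
  - apply: etrans (diff_row w dim) _.
    by apply/rowP => k; rewrite [LHS]mxE [RHS]mxE mxE.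
have k1 := congr1 (fun h => h w) (diff_comp dG' dr).
have k2 := congr1 (fun h => h w) (diff_comp dG' di).
rewrite /= dw G'z in k1 k2.
split=> //; rewrite (rderivE _ dFG) (rderivE _ dF) e1 e2.
by apply: cx_eq; [exact: k1 | exact: k2].
Qed.
(** The directions delta_k and i delta_k suffice to separate the C-linear and
    the antilinear parts of a differential. This is how Wirtinger derivatives
    of composites and of coordinates are computed. *)
Lemma dz_uniq F z (a b : 'I_m -> C) :
  (forall w, rderiv w F z = \sum_l (ofR2 w 0 l * a l + (ofR2 w 0 l)^* * b l)) ->
  forall k, dz k F z = a k /\ dzbar k F z = b k.
Proof.
move=> h k; have i2 : 'i%C * 'i%C = -1 :> C by rewrite -expr2 sqr_i.
have h1 : rderiv (delta_mx 0 k, 0) F z = a k + b k.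
  have e l : ofR2 (delta_mx 0 k : 'rV[R]_m, 0) 0 l = (l == k)%:R :> C.
    by rewrite !mxE eqxx /=; case: (l == k).
  rewrite h (bigD1 k) //= e eqxx /= big1 => [|l /negPf nlk].
    rewrite mulr1n. by rewrite conjC1 !mul1r addr0.
  by rewrite e nlk mulr0n conjC0 !mul0r addr0.
have h2 : rderiv (0, delta_mx 0 k) F z = 'i%C * a k - 'i%C * b k.
  have e l : ofR2 (0, delta_mx 0 k : 'rV[R]_m) 0 l = 'i%C * (l == k)%:R :> C.
    rewrite !mxE eqxx /=; case: (l == k); rewrite ?mulr1 ?mulr0 //.
  rewrite h (bigD1 k) //= e eqxx /= mulr1n big1 => [|l /negPf nlk].
    rewrite addr0 mulr1 conjE /=; congr (_ + _); rewrite -mulNr; congr (_ * _).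
    by apply: cx_eq; rewrite /= ?oppr0.
  by rewrite e nlk mulr0n mulr0 conjC0 !mul0r addr0.
have two : (2 : C) != 0 by rewrite pnatr_eq0.
rewrite /dz /dzbar h1 h2; move: (a k) (b k) i2 => x y; move: ('i%C : C) => i i2.
split.
- apply: (mulfI two); rewrite mulVKf // mulrBr !mulrA i2; ring.
- apply: (mulfI two); rewrite mulVKf // mulrBr !mulrA i2; ring.
Qed.

Lemma dzbarD k F G z : rdiff F z -> rdiff G z ->
  dzbar k (fun x => F x + G x) z = dzbar k F z + dzbar k G z.
Proof.
move=> dF dG; rewrite /dzbar !(rderivD _ dF dG).
by move: (rderiv _ F z) (rderiv _ F z) (rderiv _ G z) (rderiv _ G z) => a b c d; ring.
Qed.

Lemma dzM k F G z : rdiff F z -> rdiff G z ->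
  dz k (fun x => F x * G x) z = dz k F z * G z + F z * dz k G z.
Proof.
move=> dF dG; rewrite /dz !(rderivM _ dF dG).
move: (rderiv _ F z) (rderiv _ F z) (rderiv _ G z) (rderiv _ G z) => a b c d.
by move: (F z) (G z) => x y; ring.
Qed.

Lemma dzbarM k F G z : rdiff F z -> rdiff G z ->
  dzbar k (fun x => F x * G x) z = dzbar k F z * G z + F z * dzbar k G z.
Proof.
move=> dF dG; rewrite /dzbar !(rderivM _ dF dG).
move: (rderiv _ F z) (rderiv _ F z) (rderiv _ G z) (rderiv _ G z) => a b c d.
by move: (F z) (G z) => x y; ring.
Qed.

Lemma dz_cst k c z : dz k (fun=> c) z = 0.
Proof. by rewrite /dz !rderiv_cst mulr0 subrr mulr0. Qed.

Lemma dzbar_cst k c z : dzbar k (fun=> c) z = 0.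
Proof. by rewrite /dzbar !rderiv_cst mulr0 addr0 mulr0. Qed.

Lemma dz_coord k l z : dz k (fun x => x 0 l) z = (k == l)%:R.
Proof.
apply: (proj1 (dz_uniq (a := fun k => (k == l)%:R) (b := fun=> 0) _ k)) => w.
rewrite rderiv_coord (bigD1 l) //= eqxx mulr1 mulr0 addr0 big1 ?addr0 //.
by move=> j /negPf ->; rewrite !mulr0 addr0.
Qed.

Lemma rderiv_holo F z w : rdiff F z -> (forall k, dzbar k F z = 0) ->
  rderiv w F z = \sum_k ofR2 w 0 k * dz k F z.
Proof.
move=> dF hF; rewrite rderiv_wirtinger //; apply: eq_bigr => k _.
by rewrite hF mulr0 addr0.
Qed.

(** The differential of a holomorphic G is C-linear, so that it does not mix the
    C-linear and the antilinear parts of that of F. *)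
Lemma dz_comp F (G : V -> V) z k :
  rdiff F (G z) -> (forall l, rdiff (fun x => G x 0 l) z) ->
  (forall l j, dzbar j (fun x => G x 0 l) z = 0) ->
  dz k (F \o G) z = \sum_l dz k (fun x => G x 0 l) z * dz l F (G z) /\
  dzbar k (F \o G) z = \sum_l (dz k (fun x => G x 0 l) z)^* * dzbar l F (G z).
Proof.
move=> dF dG hG; move: k.
apply: (dz_uniq (a := fun k => \sum_l dz k (fun x => G x 0 l) z * dz l F (G z))
  (b := fun k => \sum_l (dz k (fun x => G x 0 l) z)^* * dzbar l F (G z))) => w.
rewrite (rderiv_comp w dF dG).2 rderiv_wirtinger // toR2K big_split big_split /=.
congr (_ + _).
- under eq_bigr => l _ do
    rewrite mxE (rderiv_holo w (dG l) (hG l)) mulr_suml.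
  rewrite exchange_big; apply: eq_bigr => j _; rewrite mulr_sumr.
  by apply: eq_bigr => l _; rewrite mulrA.
- under eq_bigr => l _ do
    rewrite mxE (rderiv_holo w (dG l) (hG l)) rmorph_sum mulr_suml.
  rewrite exchange_big; apply: eq_bigr => j _; rewrite mulr_sumr.
  by apply: eq_bigr => l _; rewrite rmorphM mulrA.
Qed.
End PointCalculus.

(** * Symmetry of second derivatives *)

Section Schwarz.
Variables (R : realType) (V : normedModType R).
Implicit Types (f : V -> R) (a w : V).

Definition second_difference f a w w' (h : R) : R :=
  f (a + h *: w' + h *: w) - f (a + h *: w) - f (a + h *: w') + f a.

Lemma derive_line f a w (t : R) : differentiable f (a + t *: w) ->
  is_derive t 1 (fun s : R => f (a + s *: w)) ('D_w f (a + t *: w)).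
Proof.
move=> df; have dr := diff_derivable (v := w) df.
pose l s := f (a + s *: w).
have q : (fun s : R => s^-1 *: ((l \o shift t) (s *: (1 : R)) - l t)) =
         (fun s : R => s^-1 *: ((f \o shift (a + t *: w)) (s *: w) - f (a + t *: w))).
  apply/funext => s; congr (_ *: (f _ - _)).
  by rewrite /= [s *: 1]mulr1 scalerDl addrCA.
by apply: DeriveDef; rewrite /derivable /derive -/l q.
Qed.

(** The mean value theorem along w turns the second difference into h times an
    increment of 'D_w f along h w', whose first-order expansion at a gives the
    estimate. *)
Lemma second_difference_approx f a w w' (e : R) :
  (\near a, differentiable f a) -> differentiable ('D_w f) a -> 0 < e ->
  \forall h \near (0:R)^'+, `|second_difference f a w w' h
      - h * h * 'D_w' ('D_w f) a| <= e * (h * h).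
Proof.
move=> df dg e0; pose g := 'D_w f; pose c := `|w| + `|w'| + 1.
have c0 : 0 < c by rewrite ltr_wpDl ?addr_ge0.
(* Both remainders in the increment are taken at distance at most h * c. *)
have eps0 : 0 < e / (c + c) by rewrite divr_gt0 // addr_gt0.
have [_ /eqaddoP/(_ _ eps0) H] := (diff_locallyP _ _).1 dg.
have df0 : \forall y \near (0 : V), differentiable f (y + a).
  by move: df; rewrite (near_shift 0 a) /= subr0.
have [r /= r0 sr] := (nbhs_ballP (0 : V) _).1 (filterI H df0).
have good y : `|y| < r -> differentiable f (a + y) /\
    `|g (a + y) - (g a + 'd g a y)| <= e / (c + c) * `|y|.
  move=> yr; have [|H1 H2] := sr y; first by rewrite -ball_normE /= sub0r normrN.
  by rewrite addrC; split.
near=> h; have h0 : 0 < h by [].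
have hc : h * c < r by rewrite -ltr_pdivlMr //; near: h; exact: nbhs_right_lt (divr_gt0 r0 c0).
have sm1 t : 0 <= t <= h -> `|t *: w| <= h * c.
  case/andP=> t0 th; rewrite normrZ ger0_norm //; apply: ler_pM => //.
  by rewrite /c -addrA lerDl addr_ge0.
have sm2 t : 0 <= t <= h -> `|h *: w' + t *: w| <= h * c.
  case/andP=> t0 th; apply: le_trans (ler_normD _ _) _.
  rewrite !normrZ (ger0_norm t0) (gtr0_norm h0).
  apply: (@le_trans _ _ (h * `|w'| + h * `|w|)); first by rewrite lerD2l ler_wpM2r.
  by rewrite -mulrDr ler_pM2l // /c [`|w'| + _]addrC lerDl.
pose phi t := f (a + h *: w' + t *: w) - f (a + t *: w).
pose dphi t := g (a + h *: w' + t *: w) - g (a + t *: w).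
have dphiP t : 0 <= t <= h -> is_derive t 1 phi (dphi t).
  move=> th; apply: is_deriveB; apply: derive_line.
  - by rewrite -addrA; apply: (good _ _).1; exact: le_lt_trans (sm2 _ th) hc.
  - by apply: (good _ _).1; exact: le_lt_trans (sm1 _ th) hc.
have [x] : exists2 x, x \in `]0, h[%R & phi h - phi 0 = dphi x * (h - 0).
  apply: MVT => //.
    by move=> x; rewrite in_itv /= => /andP[x0 xh]; apply: dphiP; rewrite !ltW.
  apply: derivable_within_continuous => x; rewrite in_itv /= => xh.
  by have := dphiP x xh; case.
rewrite in_itv /= => /andP[x0 xh] eq1.
have xh' : 0 <= x <= h by rewrite !ltW.
have -> : second_difference f a w w' h = dphi x * h.
  rewrite subr0 in eq1; rewrite -eq1 /phi /second_difference !scale0r !addr0.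
  by rewrite opprB addrA addrAC.
have [_ b1] := good _ (le_lt_trans (sm2 _ xh') hc).
have [_ b2] := good _ (le_lt_trans (sm1 _ xh') hc).
have {}b1 := le_trans b1 (ler_wpM2l (ltW eps0) (sm2 _ xh')).
have {}b2 := le_trans b2 (ler_wpM2l (ltW eps0) (sm1 _ xh')).
rewrite distrC in b2; have b := le_trans (ler_normD _ _) (lerD b1 b2).
have dlin : 'd g a (h *: w' + x *: w) = h * 'd g a w' + 'd g a (x *: w).
  exact: linearP.
rewrite (deriveE w' dg) -/g.
have main : `|dphi x - h * 'd g a w'| <= e * h.
  have -> : e * h = e / (c + c) * (h * c) + e / (c + c) * (h * c).
    rewrite -!mulrDr mulrCA divfK; first by rewrite mulrC.
    by apply: lt0r_neq0; rewrite addr_gt0.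
  apply: le_trans b; rewrite le_eqVlt; apply/orP; left; apply/eqP; congr `|_|.
  rewrite dlin /dphi [a + (_ + _)]addrA; move: ('d g a _) ('d g a _) (g _) (g _) (g _).
  by move=> p q u v t; ring.
have -> : dphi x * h - h * h * 'd g a w' = h * (dphi x - h * 'd g a w').
  by move: (dphi x) ('d g a w') => p q; ring.
by rewrite normrM (gtr0_norm h0) mulrCA ler_pM2l.
Unshelve. all: by end_near. Qed.

(** The second difference is symmetric in w and w', and divided by h^2 it is
    arbitrarily close to both iterated derivatives. *)
Lemma schwarz f a w w' : (\near a, differentiable f a) ->
  differentiable ('D_w f) a -> differentiable ('D_w' f) a ->
  'D_w' ('D_w f) a = 'D_w ('D_w' f) a.
Proof.
move=> df d1 d2; apply/eqP; rewrite -subr_eq0; apply/eqP; apply/normr0_eq0.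
apply/eqP; rewrite eq_le normr_ge0 andbT; apply/ler_addgt0Pr => e e0.
have e20 : 0 < e / 2 by rewrite divr_gt0.
have h1 := second_difference_approx w' df d1 e20.
have h2 := second_difference_approx w df d2 e20.
have [h] := @filter_ex _ (0 : R)^'+ _ _
  (filterI (filterI h1 h2) (nbhs_right_gt (0 : R))).
move=> [[k1 k2] h0].
rewrite /= in k1 k2 h0.
have sym : second_difference f a w' w h = second_difference f a w w' h.
  by rewrite /second_difference [a + _ + _]addrAC [_ - _ - f (a + h *: w)]addrAC.
have hh : 0 < h * h by rewrite mulr_gt0.
have key (s x y : R) : `|s - h * h * x| <= e / 2 * (h * h) ->
    `|s - h * h * y| <= e / 2 * (h * h) -> `|x - y| <= 0 + e.
  move=> b1 b2; rewrite distrC in b1.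
  have := le_trans (ler_normD _ _) (lerD b1 b2).
  rewrite (_ : _ + _ = h * h * (x - y)); last by ring.
  by rewrite normrM (gtr0_norm hh) -mulrDl -splitr mulrC ler_pM2r // add0r.
by rewrite sym in k2; exact: key k1 k2.
Qed.
End Schwarz.

(** * Smooth and holomorphic functions on open subsets of C^m *)

Section Smooth.
Variables (R : realType) (m : nat).
Local Notation C := (Cx R).
Local Notation V := ('rV[C]_m).
Local Notation W2 := ('rV[R]_m * 'rV[R]_m)%type.
Implicit Types (F G : V -> C) (z : V) (w : W2) (O : set V) (n : nat).

Lemma diff_upto_sub n O O' F : O' `<=` O -> diff_upto n O F -> diff_upto n O' F.
Proof.
move=> sO; elim: n F => //= n IH F [dF dF']; split=> [z /sO|w]; first exact: dF.
by apply: IH.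
Qed.

Lemma diff_uptoW n O F : diff_upto n.+1 O F -> diff_upto n O F.
Proof.
elim: n F => // n IH F [dF dF']; split=> // w; exact/IH/dF'.
Qed.

Lemma diff_upto_eq n O F G : open O -> (forall z, O z -> F z = G z) ->
  diff_upto n O F -> diff_upto n O G.
Proof.
move=> oO; elim: n F G => //= n IH F G FG [dF dF'].
have nFG z : O z -> \near z, F z = G z.
  by move=> Oz; apply: filterS FG _; exact: open_nbhs_nbhs.
split=> [z Oz|w]; first by apply: near_rdiff (nFG _ Oz) _; exact: dF.
by apply: IH (dF' w) => z Oz; exact: near_rderiv (nFG _ Oz).
Qed.

Lemma diff_upto_cst n O c : diff_upto n O (fun=> c).
Proof.
elim: n c => //= n IH c; split=> [z _|w]; first exact: rdiff_cst.
by rewrite (_ : rderiv w _ = fun=> 0) //; apply/funext => z; exact: rderiv_cst.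
Qed.

Lemma diff_uptoD n O F G : open O -> diff_upto n O F -> diff_upto n O G ->
  diff_upto n O (fun z => F z + G z).
Proof.
move=> oO; elim: n F G => //= n IH F G [dF dF'] [dG dG'].
split=> [z Oz|w]; first by apply: rdiffD; [exact: dF|exact: dG].
apply: diff_upto_eq (IH _ _ (dF' w) (dG' w)) => // z Oz.
by rewrite rderivD //; [exact: dF|exact: dG].
Qed.

Lemma diff_uptoM n O F G : open O -> diff_upto n O F -> diff_upto n O G ->
  diff_upto n O (fun z => F z * G z).
Proof.
move=> oO; elim: n F G => //= n IH F G dF1 dG1.
have dF0 := diff_uptoW dF1; have dG0 := diff_uptoW dG1.
case: dF1 dG1 => [dF dF'] [dG dG'].
split=> [z Oz|w]; first by apply: rdiffM; [exact: dF|exact: dG].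
apply: diff_upto_eq (diff_uptoD oO (IH _ _ (dF' w) dG0) (IH _ _ dF0 (dG' w))) => // z Oz.
by rewrite rderivM //; [exact: dF|exact: dG].
Qed.

Lemma diff_upto_sum n O (I : Type) (r : seq I) (P : pred I) (F : I -> V -> C) :
  open O -> (forall i, P i -> diff_upto n O (F i)) ->
  diff_upto n O (fun z => \sum_(i <- r | P i) F i z).
Proof.
move=> oO dF; elim: r => [|i r IH].
  by apply: diff_upto_eq (diff_upto_cst _ _ 0) => // z _; rewrite big_nil.
have [Pi|nPi] := boolP (P i).
  by apply: diff_upto_eq (diff_uptoD oO (dF i Pi) IH) => // z _; rewrite big_cons Pi.
by apply: diff_upto_eq IH => // z _; rewrite big_cons (negPf nPi).
Qed.

Lemma re_part_conj F : re_part (fun z => (F z)^*) = re_part F.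
Proof. by apply/funext => z; rewrite /re_part conjE. Qed.

Lemma im_part_conj F : im_part (fun z => (F z)^*) = - im_part F.
Proof. by apply/funext => z; rewrite /im_part conjE. Qed.

Lemma diff_upto_conj n O F : open O -> diff_upto n O F ->
  diff_upto n O (fun z => (F z)^*).
Proof.
move=> oO; elim: n F => //= n IH F [dF dF'].
split=> [z Oz|w].
  rewrite re_part_conj im_part_conj; have [a b] := dF z Oz.
  by split=> //; exact: differentiableN.
apply: diff_upto_eq (IH _ (dF' w)) => // z Oz.
have [a b] := dF z Oz.
rewrite conjE /= /rderiv re_part_conj im_part_conj; apply: cx_eq => //=.
by rewrite (deriveN (diff_derivable b)).
Qed.

Lemma diff_upto_dz n O F k : open O -> (forall w, diff_upto n O (rderiv w F)) ->
  diff_upto n O (dz k F) /\ diff_upto n O (dzbar k F).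
Proof.
move=> oO dF; have cM c G : diff_upto n O G -> diff_upto n O (fun z => c * G z).
  exact/diff_uptoM/diff_upto_cst.
split; apply: (cM).
- rewrite (_ : (fun z => _) = fun z => rderiv (delta_mx 0 k, 0) F z +
      (- 'i%C) * rderiv (0, delta_mx 0 k) F z).
    by apply: diff_uptoD => //; apply: (cM).
  by apply/funext => z; rewrite mulNr.
- by apply: diff_uptoD => //; apply: (cM).
Qed.

(** Induction on n: by the chain rule a derivative of F o G is a combination of
    the functions dz F o G and dzbar F o G, to which the induction hypothesis
    applies, with derivatives of G and their conjugates as coefficients. *)
Lemma diff_upto_comp n O O' F (G : V -> V) : open O -> open O' ->
  (forall z, O' z -> O (G z)) -> diff_upto n O F ->
  (forall l, diff_upto n O' (fun z => G z 0 l)) -> diff_upto n O' (F \o G).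
Proof.
move=> oO oO' sG; elim: n F => //= n IH F [dF dF'] dG.
have dG1 l z : O' z -> rdiff (fun z => G z 0 l) z by move=> ?; apply: (dG l).1.
have dG0 l : diff_upto n O' (fun z => G z 0 l) by exact/diff_uptoW/dG.
split=> [z Oz|w].
  by have [] := rderiv_comp 0 (dF _ (sG _ Oz)) (fun l => dG1 l _ Oz).
pose H z := \sum_l (rderiv w (fun z => G z 0 l) z * (dz l F \o G) z +
   (rderiv w (fun z => G z 0 l) z)^* * (dzbar l F \o G) z).
apply: (@diff_upto_eq _ _ H) => // [z Oz|].
  have dFz := dF _ (sG _ Oz).
  rewrite (rderiv_comp w dFz (fun l => dG1 l _ Oz)).2 rderiv_wirtinger // toR2K /H.
  by apply: eq_bigr => l _; rewrite mxE.
apply: diff_upto_sum => // l _; apply: diff_uptoD => //; apply: diff_uptoM => //.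
- exact: (dG l).2.
- by apply: IH => //; exact: (diff_upto_dz l oO dF').1.
- by apply: diff_upto_conj => //; exact: (dG l).2.
- by apply: IH => //; exact: (diff_upto_dz l oO dF').2.
Qed.

Lemma Csmooth_rdiff O F z : Csmooth O F -> O z -> rdiff F z.
Proof. by move=> sF Oz; have [h _] := sF 1%N; exact: h. Qed.

Lemma Csmooth_rderiv O F w : Csmooth O F -> Csmooth O (rderiv w F).
Proof. by move=> sF n; have [_] := sF n.+1; apply. Qed.

Lemma Csmooth_eq O F G : open O -> (forall z, O z -> F z = G z) ->
  Csmooth O F -> Csmooth O G.
Proof. by move=> oO FG sF n; exact: diff_upto_eq FG (sF n). Qed.

Lemma Csmooth_sub O O' F : O' `<=` O -> Csmooth O F -> Csmooth O' F.
Proof. by move=> sO sF n; exact: diff_upto_sub sO (sF n). Qed.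

Lemma Csmooth_dz O F k : open O -> Csmooth O F -> Csmooth O (dz k F).
Proof. by move=> oO sF n; apply: (diff_upto_dz k oO _).1 => w; exact: Csmooth_rderiv. Qed.

Lemma CsmoothM O F G : open O -> Csmooth O F -> Csmooth O G ->
  Csmooth O (fun z => F z * G z).
Proof. by move=> oO sF sG n; apply: diff_uptoM. Qed.

Lemma Csmooth_sum O (I : Type) (r : seq I) (P : pred I) (F : I -> V -> C) :
  open O -> (forall i, P i -> Csmooth O (F i)) ->
  Csmooth O (fun z => \sum_(i <- r | P i) F i z).
Proof. by move=> oO sF n; apply: diff_upto_sum => // i Pi; exact: sF. Qed.

Lemma rderivC O F z w w' : open O -> Csmooth O F -> O z ->
  rderiv w (rderiv w' F) z = rderiv w' (rderiv w F) z.
Proof.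
move=> oO sF Oz.
have e1 v : re_part (rderiv v F) = 'D_v (re_part F).
  by apply/funext => t; rewrite /re_part /= ofR2K.
have e2 v : im_part (rderiv v F) = 'D_v (im_part F).
  by apply/funext => t; rewrite /im_part /= ofR2K.
have dn : \forall t \near toR2 z, rdiff F (ofR2 t).
  apply: filterS (ofR2_near (open_nbhs_nbhs (conj oO Oz))) => t.
  exact: Csmooth_rdiff.
have d v : rdiff (rderiv v F) z by exact: Csmooth_rdiff (Csmooth_rderiv _ sF) Oz.
have unf v G (f g : W2 -> R) : re_part G = f -> im_part G = g ->
    rderiv v G z = ('D_v f (toR2 z) +i* 'D_v g (toR2 z))%C by move=> <- <-.
have dr v : differentiable ('D_v (re_part F)) (toR2 z).
  by rewrite -e1; exact: (d v).1.
have di v : differentiable ('D_v (im_part F)) (toR2 z).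
  by rewrite -e2; exact: (d v).2.
rewrite (unf w _ _ _ (e1 w') (e2 w')) (unf w' _ _ _ (e1 w) (e2 w)).
have nr : \forall t \near toR2 z, differentiable (re_part F) t.
  by apply: filterS dn => t [+ _]; rewrite ofR2K.
have ni : \forall t \near toR2 z, differentiable (im_part F) t.
  by apply: filterS dn => t [_ +]; rewrite ofR2K.
exact: (f_equal2 _ (schwarz nr (dr w') (dr w)) (schwarz ni (di w') (di w))).
Qed.

Lemma rderiv_comb w (c d : C) F G z : rdiff F z -> rdiff G z ->
  rderiv w (fun x => c * (F x + d * G x)) z =
  c * (rderiv w F z + d * rderiv w G z).
Proof.
move=> dF dG; have dd := rdiffM (rdiff_cst d z) dG.
rewrite (rderivM w (rdiff_cst c z) (rdiffD dF dd)) (rderivD w dF dd).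
by rewrite (rderivM w (rdiff_cst d z) dG) !rderiv_cst !mul0r !add0r.
Qed.

Lemma dzbar_dz O F z j k : open O -> Csmooth O F -> O z ->
  dzbar j (dz k F) z = dz k (dzbar j F) z.
Proof.
move=> oO sF Oz; have d v : rdiff (rderiv v F) z.
  exact: Csmooth_rdiff (Csmooth_rderiv _ sF) Oz.
have e1 : dz k F = fun x => 2^-1 * (rderiv (delta_mx 0 k, 0) F x +
    (- 'i%C) * rderiv (0, delta_mx 0 k) F x).
  by apply/funext => x; rewrite mulNr.
have e2 : dzbar j F = fun x => 2^-1 * (rderiv (delta_mx 0 j, 0) F x +
    'i%C * rderiv (0, delta_mx 0 j) F x) := erefl.
rewrite e1 e2 [LHS]/dzbar [RHS]/dz !(rderiv_comb _ _ _ (d _) (d _)).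
rewrite !(rderivC (delta_mx 0 j, 0) _ oO sF Oz).
rewrite !(rderivC (0, delta_mx 0 j) _ oO sF Oz).
have key (h i p q r s : C) : h * (h * (p + - i * q) + i * (h * (r + - i * s))) =
    h * (h * (p + i * r) - i * (h * (q + i * s))) by ring.
exact: key.
Qed.

(** dzbar (dz F) = dz (dzbar F) = 0, since second derivatives commute. *)
Lemma Cholo_dz O F k : open O -> Cholo O F -> Cholo O (dz k F).
Proof.
move=> oO [sF hF]; split=> [|j z Oz]; first exact: Csmooth_dz.
rewrite (dzbar_dz _ _ oO sF Oz) -(dz_cst k 0 z); apply: near_dz.
by apply: filterS (hF j) _; exact: open_nbhs_nbhs.
Qed.

Lemma Cholo_sub O O' F : O' `<=` O -> Cholo O F -> Cholo O' F.
Proof.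
move=> sO [sF hF]; split=> [|k z /sO]; [exact: Csmooth_sub sO sF|exact: hF].
Qed.

Lemma Cholo_eq O F G : open O -> (forall z, O z -> F z = G z) ->
  Cholo O F -> Cholo O G.
Proof.
move=> oO FG [sF hF]; split=> [|k z Oz]; first exact: Csmooth_eq FG sF.
rewrite -(hF k z Oz); apply/esym/near_dzbar.
by apply: filterS FG _; exact: open_nbhs_nbhs.
Qed.

Lemma Cholo_cst O c : Cholo O (fun=> c).
Proof.
split=> [n|k z _]; [exact: diff_upto_cst|exact: dzbar_cst].
Qed.

Lemma CholoD O F G : open O -> Cholo O F -> Cholo O G -> Cholo O (fun z => F z + G z).
Proof.
move=> oO [sF hF] [sG hG]; split=> [n|k z Oz]; first exact: diff_uptoD.
have dF := Csmooth_rdiff sF Oz; have dG := Csmooth_rdiff sG Oz.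
by rewrite dzbarD // hF // hG // addr0.
Qed.

Lemma CholoM O F G : open O -> Cholo O F -> Cholo O G -> Cholo O (fun z => F z * G z).
Proof.
move=> oO [sF hF] [sG hG]; split=> [|k z Oz]; first exact: CsmoothM.
have dF := Csmooth_rdiff sF Oz; have dG := Csmooth_rdiff sG Oz.
by rewrite dzbarM // hF // hG // mul0r mulr0 addr0.
Qed.

Lemma Cholo_sum O (I : Type) (r : seq I) (P : pred I) (F : I -> V -> C) :
  open O -> (forall i, P i -> Cholo O (F i)) ->
  Cholo O (fun z => \sum_(i <- r | P i) F i z).
Proof.
move=> oO dF; elim: r => [|i r IH].
  by apply: Cholo_eq (Cholo_cst _ 0) => // z _; rewrite big_nil.
have [Pi|nPi] := boolP (P i).
  by apply: Cholo_eq (CholoD oO (dF i Pi) IH) => // z _; rewrite big_cons Pi.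
by apply: Cholo_eq IH => // z _; rewrite big_cons (negPf nPi).
Qed.

Lemma Cholo_comp O O' F (G : V -> V) : open O -> open O' ->
  (forall z, O' z -> O (G z)) -> Cholo O F -> Cholo_map O' G -> Cholo O' (F \o G).
Proof.
move=> oO oO' sG [sF hF] hG; split=> [n|k z Oz].
  by apply: diff_upto_comp oO oO' sG (sF n) _ => l; exact: (hG l).1.
have dF := Csmooth_rdiff sF (sG _ Oz).
have dG l := Csmooth_rdiff (hG l).1 Oz.
rewrite (dz_comp k dF dG _).2 => [|l j]; last exact: (hG l).2.
by rewrite big1 // => l _; rewrite hF ?mulr0 //; exact: sG.
Qed.

(** The mean value theorem on the segment from the centre z0 to z, for the real
    and the imaginary parts. *)
Lemma constant_on_ball F z0 (r : C) :
  (forall z, ball z0 r z -> rdiff F z) ->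
  (forall z k, ball z0 r z -> dz k F z = 0 /\ dzbar k F z = 0) ->
  forall z, ball z0 r z -> F z = F z0.
Proof.
move=> dF hF z Bz; pose a := toR2 z0; pose w := toR2 z - a.
have seg (t : R) : 0 <= t <= 1 -> ball z0 r (ofR2 (a + t *: w)).
  move=> /andP[t0 t1]; have -> : ofR2 (a + t *: w) = z0 + (t%:C)%C *: (z - z0).
    by apply/rowP => k; rewrite !mxE; apply: cx_eq; case: (z0 0 k) => x y;
       case: (z 0 k) => x' y'; rewrite /= ?mul0r ?subr0 ?addr0.
  move: Bz; rewrite -ball_normE /= => Bz.
  rewrite opprD addNKr normrN normrZ distrC; apply: le_lt_trans Bz.
  rewrite -[leRHS]mul1r ler_wpM2r //.
  rewrite normc_def /= expr0n addr0 sqrtr_sqr ger0_norm //.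
  by rewrite -[X in _ <= X]/((1%:C)%C) lecR.
have zero p : ball z0 r (ofR2 p) -> rderiv w F (ofR2 p) = 0.
  move=> Bp; rewrite rderiv_wirtinger; last exact: dF.
  by rewrite big1 // => k _; have [-> ->] := hF _ k Bp; rewrite !mulr0 addr0.
have key (f : W2 -> R) : (forall p, ball z0 r (ofR2 p) -> differentiable f p) ->
    (forall p, ball z0 r (ofR2 p) -> 'D_w f p = 0) -> f (a + w) = f a.
  move=> df Df; pose phi (s : R) := f (a + s *: w).
  have dphi (t : R) : 0 <= t <= 1 -> is_derive t (1 : R) phi 0.
    by move=> /seg Bt; rewrite -(Df _ Bt); apply/derive_line/df.
  pose phi' (s : R) := 0 : R.
  have [x _] : exists2 x : R, x \in `]0, 1[%R & phi 1 - phi 0 = phi' x * (1 - 0).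
    apply: MVT => //.
      by move=> x; rewrite in_itv /= => /andP[x0 x1]; apply: dphi; rewrite !ltW.
    apply: derivable_within_continuous => x; rewrite in_itv /= => x01.
    by have := dphi x x01; case.
  rewrite mul0r /phi scale1r scale0r addr0 => /eqP.
  by rewrite subr_eq0 => /eqP.
have aw : a + w = toR2 z by rewrite /w addrCA subrr addr0.
apply: cx_eq.
- have := key (re_part F); rewrite aw /re_part !toR2K; apply.
  + by move=> p Bp; have [] := dF _ Bp; rewrite ofR2K.
  + by move=> p Bp; have := zero p Bp; rewrite /rderiv ofR2K => -[].
- have := key (im_part F); rewrite aw /im_part !toR2K; apply.
  + by move=> p Bp; have [] := dF _ Bp; rewrite ofR2K.
  + by move=> p Bp; have := zero p Bp; rewrite /rderiv ofR2K => -[].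
Qed.
End Smooth.

(** * Coordinates, derivations and vector fields on a complex manifold *)

Section Manifold.
Variables (R : realType) (m : nat) (M : complex_manifold R m).
Local Notation C := (Cx R).
Local Notation V := ('rV[C]_m).
Implicit Types (U O : set M) (f : M -> C) (p q : M) (X Y : vfield M).

(** The image is the preimage of O by the inverse chart. *)
Lemma chart_image_open (T : topologicalType) (U O : set T) (u : T -> V) v :
  is_chart U u v -> open O -> open (u @` (O `&` U)).
Proof.
case=> oU ouU vK _ vc oO; rewrite openE => _ [p [Op Up] <-].
have uUup : (u @` U) (u p) by exists p.
have n1 : nbhs (u p) (u @` U) by exact: open_nbhs_nbhs.
have n2 : nbhs (u p) (v @^-1` O).
  by apply: (vc _ uUup); rewrite vK //; exact: open_nbhs_nbhs.
apply: filterS (filterI n1 n2) => z [[q Uq <-]]; rewrite /= vK // => Oq.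
by exists q.
Qed.

Lemma chart_preimage_open (T : topologicalType) (U : set T) (u : T -> V) v B :
  is_chart U u v -> open B -> open [set q | U q /\ B (u q)].
Proof.
case=> oU _ _ uc _ oB; rewrite openE => q [Uq Bq].
have nB : nbhs (u q) B by exact: open_nbhs_nbhs.
have nu : nbhs q (u @^-1` B) := uc q Uq B nB.
have nU : nbhs q U by exact: open_nbhs_nbhs.
exact: (filterI nU nu).
Qed.

(** Both the charts of the atlas and the local coordinates given by
    semi-simplicity have this form, so that the lemmas below apply to either;
    the inverse is explicit because derivatives are taken on functions f o v. *)
Definition coords_inv U (u : M -> V) (v : V -> M) := is_chart U u v /\
    forall i, Cholo_map (man_chart i @` (U `&` man_dom i)) (u \o man_inv i) /\
              Cholo_map (u @` (U `&` man_dom i)) (man_chart i \o v).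

Lemma man_coords (i : man_atlas M) :
  coords_inv (man_dom i) (man_chart i) (man_inv i).
Proof.
split=> [|j]; first exact: man_chartP.
by split; [rewrite setIC; exact: man_trans|exact: man_trans].
Qed.

Section Coords.
Variables (U : set M) (u : M -> V) (v : V -> M).
Hypothesis uv : coords_inv U u v.

Lemma coords_open : open U. Proof. by case: uv.1. Qed.

Lemma coordsK p : U p -> v (u p) = p.
Proof. by case: uv.1 => _ _ + _ _; apply. Qed.

Lemma coords_image O : open O -> open (u @` (U `&` O)).
Proof. by rewrite setIC; exact: (chart_image_open uv.1). Qed.

Lemma coords_near p O (P : V -> Prop) : U p -> open O -> O p ->
  (forall q, U q -> O q -> P (u q)) -> \forall z \near u p, P z.
Proof.
move=> Up oO Op H; have n : nbhs (u p) (u @` (U `&` O)).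
  by apply: open_nbhs_nbhs; split; [exact: coords_image|exists p].
by apply: filterS n => _ [q [Uq Oq] <-]; exact: H.
Qed.
End Coords.

Section ChangeOfCoords.
Variables (U : set M) (u : M -> V) (v : V -> M).
Hypothesis uv : coords_inv U u v.
Let at_chart p := man_chart (man_at p).
Let at_inv p := man_inv (man_at p).

Lemma man_near f1 f2 p (i : man_atlas M) O : man_dom i p -> open O -> O p ->
  (forall q, O q -> f1 q = f2 q) ->
  \forall z \near man_chart i p, (f1 \o man_inv i) z = (f2 \o man_inv i) z.
Proof.
move=> ip oO Op f12; apply: (coords_near (man_coords i) ip oO Op) => q iq Oq.
by rewrite /= (coordsK (man_coords i) iq); exact: f12.
Qed.

Lemma vder_near f1 f2 p x O : open O -> O p -> (forall q, O q -> f1 q = f2 q) ->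
  vder p x f1 = vder p x f2.
Proof.
move=> oO Op f12; apply: eq_bigr => k _; congr (_ * _); apply: near_dz.
exact: (man_near (man_at_dom p) oO Op f12).
Qed.

Lemma coords_factor f p (i : man_atlas M) : U p -> man_dom i p ->
  \forall z \near man_chart i p, ((f \o v) \o (u \o man_inv i)) z = (f \o man_inv i) z.
Proof.
move=> Up ip; apply: (coords_near (man_coords i) ip (coords_open uv) Up) => q iq Uq.
by rewrite /= (coordsK (man_coords i) iq) (coordsK uv Uq).
Qed.

Lemma coords_factor_inv f p (i : man_atlas M) : U p -> man_dom i p ->
  \forall z \near u p, ((f \o man_inv i) \o (man_chart i \o v)) z = (f \o v) z.
Proof.
move=> Up ip; apply: (coords_near uv Up (coords_open (man_coords i)) ip) => q Uq iq.
by rewrite /= (coordsK uv Uq) (coordsK (man_coords i) iq).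
Qed.

Lemma coords_holo p (i : man_atlas M) l : U p -> man_dom i p ->
  let G := fun z => (u \o man_inv i) z 0 l in
  rdiff G (man_chart i p) /\ forall j, dzbar j G (man_chart i p) = 0.
Proof.
move=> Up ip G; have [hG1 hG2] := (uv.2 i).1 l.
have ipi : (man_chart i @` (U `&` man_dom i)) (man_chart i p) by exists p.
by split; [exact: Csmooth_rdiff hG1 ipi|move=> j; exact: hG2].
Qed.

Lemma coords_inv_holo p (i : man_atlas M) l : U p -> man_dom i p ->
  let G := fun z => (man_chart i \o v) z 0 l in
  rdiff G (u p) /\ forall j, dzbar j G (u p) = 0.
Proof.
move=> Up ip G; have [hG1 hG2] := (uv.2 i).2 l.
have ipi : (u @` (U `&` man_dom i)) (u p) by exists p.
by split; [exact: Csmooth_rdiff hG1 ipi|move=> j; exact: hG2].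
Qed.

Lemma rdiff_coords f p (i : man_atlas M) : U p -> man_dom i p ->
  rdiff (f \o man_inv i) (man_chart i p) -> rdiff (f \o v) (u p).
Proof.
move=> Up ip df; apply: near_rdiff (coords_factor_inv f Up ip) _.
have [] // := rderiv_comp 0 (F := f \o man_inv i) (G := man_chart i \o v) (z := u p).
  by rewrite /= (coordsK uv Up).
by move=> l; exact: (coords_inv_holo l Up ip).1.
Qed.

(** The function f is the composite of f o v and of the holomorphic map u. *)
Lemma vder_coords f p x : U p -> rdiff (f \o v) (u p) ->
  vder p x f = \sum_l vder p x (fun q => u q 0 l) * dz l (f \o v) (u p).
Proof.
move=> Up df; have ip := man_at_dom p; set i := man_at p in ip.
have uip : (u \o man_inv i) (man_chart i p) = u p.
  by rewrite /= (coordsK (man_coords i) ip).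
have df' : rdiff (f \o v) ((u \o man_inv i) (man_chart i p)) by rewrite uip.
have comp k := dz_comp k df' (fun l => (coords_holo l Up ip).1)
   (fun l => (coords_holo l Up ip).2).
rewrite /vder -/i; under eq_bigr => k _ do
  rewrite -(near_dz k (coords_factor f Up ip)) (comp k).1 uip mulr_sumr.
rewrite exchange_big; apply: eq_bigr => l _; rewrite mulr_suml.
by apply: eq_bigr => k _; rewrite mulrA.
Qed.

Let jac p := \matrix_(k, l) vder p (delta_mx 0 k) (fun q => u q 0 l).
Let jac_inv p := \matrix_(a, l) dz a (fun z => (at_chart p \o v) z 0 l) (u p).

Lemma vder_delta p k f : vder p (delta_mx 0 k) f =
  dz k (f \o at_inv p) (at_chart p p).
Proof.
rewrite /vder (bigD1 k) //= mxE !eqxx mul1r big1 ?addr0 // => j /negPf jk.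
by rewrite mxE jk andbF mul0r.
Qed.

Lemma vder_jac p x l : vder p x (fun q => u q 0 l) = (x *m jac p) 0 l.
Proof. by rewrite mxE; apply: eq_bigr => k _; rewrite mxE vder_delta. Qed.

(** The chain rule for u o v = id. *)
Lemma jac_invP p : U p -> jac_inv p *m jac p = 1%:M.
Proof.
move=> Up; have ip := man_at_dom p; set i := man_at p in ip.
have ci : (man_chart i \o v) (u p) = man_chart i p by rewrite /= (coordsK uv Up).
apply/matrixP => a b; rewrite !mxE.
have dG l := (coords_inv_holo l Up ip).1.
have hG l := (coords_inv_holo l Up ip).2.
have dF : rdiff (fun z => (u \o man_inv i) z 0 b) ((man_chart i \o v) (u p)).
  by rewrite ci; exact: (coords_holo b Up ip).1.
have := (dz_comp a dF dG hG).1; rewrite ci.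
under eq_bigr => l _ do rewrite -[dz l _ _](vder_delta p l (fun q => u q 0 b)).
under [X in _ -> X = _]eq_bigr => l _ do rewrite !mxE.
move=> <-; rewrite -(dz_coord a b (u p)); apply: near_dz.
apply: (coords_near uv Up (coords_open (man_coords i)) ip) => q Uq iq.
by rewrite /= (coordsK uv Uq) (coordsK (man_coords i) iq).
Qed.

Lemma jac_unit p : U p -> jac p \in unitmx.
Proof. by move/jac_invP/mulmx1_unit => []. Qed.

Lemma coord_fieldE p a : U p -> coord_field u a p = row a (jac_inv p).
Proof.
move=> Up; rewrite /coord_field -/(jac p); congr row.
by rewrite -[LHS]mul1mx -(jac_invP Up) mulmxK // jac_unit.
Qed.

Lemma vder_coord_field_coord p a b : U p ->
  vder p (coord_field u a p) (fun q => u q 0 b) = (a == b)%:R.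
Proof.
move=> Up; rewrite vder_jac coord_fieldE // -row_mul jac_invP //.
by rewrite rowE mulmx1 mxE eqxx eq_sym.
Qed.

Lemma vder_coord_field p a f : U p -> rdiff (f \o v) (u p) ->
  vder p (coord_field u a p) f = dz a (f \o v) (u p).
Proof.
move=> Up df; rewrite (vder_coords _ Up df) (bigD1 a) //=.
rewrite vder_coord_field_coord // eqxx mul1r big1 ?addr0 // => b /negPf ba.
by rewrite vder_coord_field_coord // eq_sym ba mul0r.
Qed.

Lemma coord_expand p x : U p ->
  x = \sum_a vder p x (fun q => u q 0 a) *: coord_field u a p.
Proof.
move=> Up; rewrite -[LHS](mulmxK (jac_unit Up)) [LHS]mulmx_sum_row.
by apply: eq_bigr => a _; rewrite vder_jac.
Qed.

(** In the chart i, the components of d/du^a are the derivatives d/du^a of the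
    transition map from u to that chart, evaluated at u. *)
Lemma holo_coord_field a : holo_field U (coord_field u a).
Proof.
move=> i l j; have oU := coords_open uv.
have oi := coords_open (man_coords i).
set O' := _ @` _.
have oO' : open O' by apply: (chart_image_open (man_chartP j)); exact: openI.
have hd := Cholo_dz a (coords_image uv oi) ((uv.2 i).2 l).
have hu : Cholo_map O' (u \o man_inv j).
  move=> k; apply: Cholo_sub ((uv.2 j).1 k) => _ [q [[Uq _] jq] <-].
  by exists q.
apply: Cholo_eq (Cholo_comp (coords_image uv oi) oO' _ hd hu) => //.
- move=> _ [q [[Uq iq] jq] <-]; rewrite /= (coordsK (man_coords j) jq).
  rewrite /vcomp mxE vder_coord_field //.
  exact: (coords_inv_holo l Uq iq).1.
- move=> _ [q [[Uq iq] jq] <-]; rewrite /= (coordsK (man_coords j) jq).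
  by exists q.
Qed.

End ChangeOfCoords.

Lemma vder_lin p k (x y : V) f : vder p (k *: x + y) f = k * vder p x f + vder p y f.
Proof.
rewrite /vder mulr_sumr -big_split; apply: eq_bigr => j _ /=.
by rewrite !mxE mulrDl mulrA.
Qed.

Lemma vcomp_lin i p k (x y : V) : vcomp (M:=M) i p (k *: x + y) = k *: vcomp i p x + vcomp i p y.
Proof. by apply/rowP => l; rewrite !mxE vder_lin. Qed.

Lemma vcompZ i p k (x : V) : vcomp (M:=M) i p (k *: x) = k *: vcomp i p x.
Proof.
apply/rowP => l; rewrite !mxE /vder mulr_sumr.
by apply: eq_bigr => j _; rewrite !mxE mulrA.
Qed.

Lemma smooth_fun_rdiff U f p i : smooth_fun U f -> U p -> man_dom i p ->
  rdiff (f \o man_inv i) (man_chart i p).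
Proof. by move=> sf Up ip; apply: Csmooth_rdiff (sf i) _; exists p. Qed.

Lemma holo_smooth_fun U f : holo_fun U f -> smooth_fun U f.
Proof. by move=> hf i; case: (hf i). Qed.

Lemma holo_smooth_field U X : holo_field U X -> smooth_field U X.
Proof. by move=> hX i l; exact: holo_smooth_fun. Qed.

Lemma smooth_fun_sub U O f : O `<=` U -> smooth_fun U f -> smooth_fun O f.
Proof.
by move=> sO sf i; apply: Csmooth_sub (sf i) => _ [q [/sO Uq iq] <-]; exists q.
Qed.

Lemma holo_fun_sub U O f : O `<=` U -> holo_fun U f -> holo_fun O f.
Proof.
by move=> sO sf i; apply: Cholo_sub (sf i) => _ [q [/sO Uq iq] <-]; exists q.
Qed.

Lemma smooth_field_sub U O X : O `<=` U -> smooth_field U X -> smooth_field O X.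
Proof. by move=> sO sX i l; apply: smooth_fun_sub (sX i l) => q [/sO]. Qed.

Lemma man_image_open i O : open O -> open (man_chart i @` (O `&` man_dom (c:=M) i)).
Proof. exact: (chart_image_open (man_chartP i)). Qed.

Lemma smooth_fun_eq U f1 f2 : open U -> (forall q, U q -> f1 q = f2 q) ->
  smooth_fun U f1 -> smooth_fun U f2.
Proof.
move=> oU f12 sf i; apply: Csmooth_eq (sf i); first exact: man_image_open.
by move=> _ [q [Uq iq] <-]; rewrite /= (coordsK (man_coords i) iq) f12.
Qed.

Lemma smooth_field_eq U X Y : open U -> (forall q, U q -> X q = Y q) ->
  smooth_field U X -> smooth_field U Y.
Proof.
move=> oU XY sX i l; apply: smooth_fun_eq (sX i l).
  by apply: openI => //; exact: coords_open (man_coords i).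
by move=> q [Uq _]; rewrite XY.
Qed.

Lemma smooth_fun_cst U c : smooth_fun (M:=M) U (fun=> c).
Proof. by move=> i n; exact: diff_upto_cst. Qed.

Lemma smooth_funM U f1 f2 : open U -> smooth_fun U f1 -> smooth_fun U f2 ->
  smooth_fun U (fun q => f1 q * f2 q).
Proof. by move=> oU s1 s2 i; apply: CsmoothM (s1 i) (s2 i); exact: man_image_open. Qed.

Lemma smooth_fieldZ U f X : open U -> smooth_fun U f -> smooth_field U X ->
  smooth_field U (fun q => f q *: X q).
Proof.
move=> oU sf sX i l; have oi := openI oU (coords_open (man_coords i)).
apply: smooth_fun_eq (smooth_funM oi (smooth_fun_sub _ sf) (sX i l)) => //.
by move=> q _; rewrite vcompZ [RHS]mxE.
Qed.

Lemma smooth_field_sum U (I : Type) (r : seq I) (X : I -> vfield M) : open U ->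
  (forall i, smooth_field U (X i)) -> smooth_field U (fun q => \sum_(i <- r) X i q).
Proof.
move=> oU sX i l; have oi := openI oU (coords_open (man_coords i)).
apply: (@smooth_fun_eq _ (fun q => \sum_(k <- r) vcomp i q (X k q) 0 l)) => //.
  move=> q _; elim: r => [|k r IH].
    by rewrite !big_nil -[0 in RHS](scale0r 0) vcompZ scale0r mxE.
  by rewrite !big_cons -[X k q in RHS]scale1r vcomp_lin scale1r [RHS]mxE IH.
move=> j; apply: Csmooth_sum; first exact: man_image_open.
by move=> k _; exact: sX.
Qed.

Lemma smooth_field0 U : open U -> smooth_field U (fun=> 0 : V).
Proof.
move=> oU i l; apply: smooth_fun_eq (smooth_fun_cst _ 0).
  by apply: openI => //; exact: coords_open (man_coords i).
by move=> q _; rewrite -[0 in RHS](scale0r 0) vcompZ scale0r [RHS]mxE.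
Qed.

(** Smoothness is seen in one fixed chart j, although the definition of [vder]
    at q involves a chart that varies with q. *)
Lemma smooth_vder U X f : open U -> smooth_field U X -> smooth_fun U f ->
  smooth_fun U (fun q => vder q (X q) f).
Proof.
move=> oU sX sf j; set O := _ @` _.
have oO : open O by exact: man_image_open.
apply: (@Csmooth_eq _ _ _ (fun z => \sum_l
    ((fun q => vcomp j q (X q) 0 l) \o man_inv j) z * dz l (f \o man_inv j) z)) => //.
  move=> _ [q [Uq jq] <-]; rewrite /= (coordsK (man_coords j) jq).
  rewrite (vder_coords (man_coords j) _ jq); last exact: smooth_fun_rdiff sf Uq jq.
  by apply: eq_bigr => l _; rewrite mxE.
apply: Csmooth_sum => // l _; apply: CsmoothM => //.
- apply: Csmooth_sub (sX j l j) => _ [q [Uq jq] <-]; by exists q.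
- by apply: Csmooth_dz => //; exact: sf.
Qed.

Lemma vderM U f1 f2 p x : U p -> smooth_fun U f1 -> smooth_fun U f2 ->
  vder p x (fun q => f1 q * f2 q) = vder p x f1 * f2 p + f1 p * vder p x f2.
Proof.
move=> Up s1 s2; have ip := man_at_dom p.
have d1 := smooth_fun_rdiff s1 Up ip; have d2 := smooth_fun_rdiff s2 Up ip.
rewrite /vder mulr_suml mulr_sumr -big_split; apply: eq_bigr => k _.
rewrite [(fun q => _) \o _]/(comp _ _) (dzM _ d1 d2) /=.
by rewrite (coordsK (man_coords _) ip); ring.
Qed.

Lemma dbar_holo U X p x : open U -> U p -> holo_field U X -> dbar p x X = 0.
Proof.
move=> oU Up hX; apply/rowP => l; rewrite !mxE /vbarder big1 // => k _.
have [_ h] := hX (man_at p) l (man_at p); rewrite h ?mulr0 //.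
by exists p => //; split; [split|]=> //; exact: man_at_dom.
Qed.
End Manifold.

(** * Sums of cubes of coordinates *)

Section CubicPotential.
Variables (R : realType) (m : nat).
Local Notation C := (Cx R).

Definition cubic (c : 'I_m -> C) : mpoly m C :=
  \sum_(i < m) c i *: mpolyX C (mnm_muln (mnm1 i) 3).

Lemma msize_cubic c : (msize (cubic c) <= 4)%N.
Proof.
apply: leq_trans (mmeasure_sum _ _ _ _) _.
apply/bigmax_leqP => i _; apply: leq_trans (msizeZ_le _ _) _.
by rewrite msizeX mdegMn mdeg1.
Qed.

Lemma meval_cubic c (x : 'I_m -> C) :
  meval x (cubic c) = \sum_i c i * (x i * (x i * x i)).
Proof.
rewrite /cubic raddf_sum /=; apply: eq_bigr => i _.
rewrite mevalZ mevalX (bigD1 i) //= big1 => [|j /negPf ji].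
  by rewrite mulr1 mulmnE mnm1E eqxx !exprS expr0 mulr1.
by rewrite mulmnE mnm1E eq_sym ji.
Qed.
End CubicPotential.

Section CoordinateFunctions.
Variables (R : realType) (m : nat) (M : complex_manifold R m).
Local Notation C := (Cx R).
Local Notation V := ('rV[C]_m).
Variables (U : set M) (u : M -> V) (v : V -> M).
Hypothesis uv : coords_inv U u v.

Lemma coord_holo_fun l : holo_fun U (fun q => u q 0 l).
Proof. by move=> i; exact: (uv.2 i).1. Qed.

Lemma vder_sum p x (f : 'I_m -> M -> C) : U p -> (forall i, smooth_fun U (f i)) ->
  vder p x (fun q => \sum_i f i q) = \sum_i vder p x (f i).
Proof.
move=> Up sf; have ip := man_at_dom p.
rewrite /vder exchange_big; apply: eq_bigr => k _; rewrite -mulr_sumr.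
congr (_ * _); set z := man_chart _ _.
have e w : rderiv w ((fun q => \sum_i f i q) \o man_inv (man_at p)) z =
    \sum_i rderiv w (f i \o man_inv (man_at p)) z.
  by apply: rderiv_sum => i _; exact: smooth_fun_rdiff (sf i) Up ip.
by rewrite /dz !e mulr_sumr -sumrB mulr_sumr.
Qed.

Lemma vder_cst (p : M) x c : vder p x (fun=> c) = 0.
Proof. by rewrite /vder big1 // => k _; rewrite -[dz _ _ _]/(dz k (fun=> c) _) dz_cst mulr0. Qed.

Lemma coords_inv_sub O : open O -> O `<=` U -> coords_inv O u v.
Proof.
move=> oO sO; split.
  case: (uv.1) => oU ouU vK cu cv; split => //.
  - rewrite -(setIidl sO); exact: (chart_image_open uv.1).
  - by move=> p /sO; exact: vK.
  - by move=> p /sO; exact: cu.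
  - by move=> z [p /sO Up <-]; apply: cv; exists p.
move=> i; split=> l.
- by apply: Cholo_sub ((uv.2 i).1 l) => _ [q [/sO Uq iq] <-]; exists q.
- by apply: Cholo_sub ((uv.2 i).2 l) => _ [q [/sO Uq iq] <-]; exists q.
Qed.

(** Both Wirtinger derivatives of the expression f o v vanish on the ball. *)
Lemma holo_fun_constant f p (r : C) : holo_fun U f ->
  (forall q a, U q -> vder q (coord_field u a q) f = 0) ->
  U p -> ball (u p) r `<=` u @` U -> 0 < r ->
  forall q, U q -> ball (u p) r (u q) -> f q = f p.
Proof.
move=> hf df Up sB r0 q Uq Bq.
have dfv q' : U q' -> rdiff (f \o v) (u q').
  move=> Uq'; apply: (rdiff_coords uv Uq' (man_at_dom q')).
  exact: smooth_fun_rdiff (holo_smooth_fun hf) Uq' (man_at_dom q').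
have fv p' : U p' -> f p' = (f \o v) (u p') by move=> Up'; rewrite /= (coordsK uv).
rewrite (fv q Uq) (fv p Up); apply: (constant_on_ball _ _ Bq).
- by move=> z /sB[q' Uq' <-]; exact: dfv.
- move=> z k /sB[q' Uq' <-]; split.
    by rewrite -(vder_coord_field uv k Uq' (dfv _ Uq')) df.
  have iq := man_at_dom q'.
  have ci : (man_chart (man_at q') \o v) (u q') = man_chart (man_at q') q'.
    by rewrite /= (coordsK uv Uq').
  rewrite -(near_dzbar k (coords_factor_inv uv f Uq' iq)).
  rewrite (dz_comp (F := f \o man_inv (man_at q')) k _
    (fun l => (coords_inv_holo uv l Uq' iq).1)
    (fun l => (coords_inv_holo uv l Uq' iq).2)).2.
    rewrite big1 // => l _; rewrite ci.
    have [_ h] := hf (man_at q'); rewrite h ?mulr0 //.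
    by exists q'.
  by rewrite ci; exact: smooth_fun_rdiff (holo_smooth_fun hf) Uq' iq.
Qed.

Lemma holo_funM f1 f2 :
  holo_fun U f1 -> holo_fun U f2 -> holo_fun U (fun q => f1 q * f2 q).
Proof.
move=> h1 h2 n; apply: CholoM (h1 n) (h2 n).
exact: man_image_open (coords_open uv).
Qed.

Lemma holo_fun_cst c : holo_fun (M:=M) U (fun=> c).
Proof. by move=> n; exact: Cholo_cst. Qed.

Lemma holo_fun_cube c l :
  holo_fun U (fun q => c * (u q 0 l * (u q 0 l * u q 0 l))).
Proof.
apply: (holo_funM (holo_fun_cst c)); have hl := @coord_holo_fun l.
exact: (holo_funM hl (holo_funM hl hl)).
Qed.

Lemma holo_fun_cubic (c : 'I_m -> C) :
  holo_fun U (fun q => \sum_l c l * (u q 0 l * (u q 0 l * u q 0 l))).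
Proof.
move=> n; apply: Cholo_sum => [|l _]; last exact: holo_fun_cube.
exact: man_image_open (coords_open uv).
Qed.

Lemma cubic_derivatives (c : 'I_m -> C) i j k q : U q ->
  let d_ i f := fun q => vder q (coord_field u i q) f in
  d_ i (d_ j (d_ k (fun q => \sum_l c l * (u q 0 l * (u q 0 l * u q 0 l))))) q =
  6 * c k * (j == k)%:R * (i == k)%:R.
Proof.
move=> Uq d_; set F := fun q => \sum_l _.
have oU := coords_open uv; pose x l q := u q 0 l.
have hx l : holo_fun U (x l) by exact: coord_holo_fun.
have hM := holo_funM; have hc := holo_fun_cst.
have hcube l : holo_fun U (fun q => c l * (x l q * (x l q * x l q))).
  exact: holo_fun_cube.
have sx l := holo_smooth_fun (hx l).
have dx a l q' : U q' -> vder q' (coord_field u a q') (x l) = (a == l)%:R.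
  by move=> Uq'; rewrite (vder_coord_field_coord uv).
have sxx l := holo_smooth_fun (hM _ _ (hx l) (hx l)).
have sc a := holo_smooth_fun (hc a).
have d1 q' : U q' -> d_ k F q' = 3 * c k * (x k q' * x k q').
  move=> Uq'; rewrite /d_ /F (vder_sum _ Uq' (fun l => holo_smooth_fun (hcube l))).
  rewrite (bigD1 k) //= big1 => [|l /negPf lk].
    rewrite (vderM _ Uq' (sc _) (holo_smooth_fun (hM _ _ (hx _) (hM _ _ (hx _) (hx _))))).
    rewrite (vderM _ Uq' (sx _) (sxx _)) (vderM _ Uq' (sx _) (sx _)).
    by rewrite vder_cst dx // eqxx mulr1n; ring.
  rewrite (vderM _ Uq' (sc _) (holo_smooth_fun (hM _ _ (hx _) (hM _ _ (hx _) (hx _))))).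
  rewrite (vderM _ Uq' (sx _) (sxx _)) (vderM _ Uq' (sx _) (sx _)).
  by rewrite vder_cst dx // eq_sym lk mulr0n; ring.
have d2 q' : U q' -> d_ j (d_ k F) q' = 6 * c k * (j == k)%:R * x k q'.
  move=> Uq'; rewrite {1}/d_ (vder_near _ oU Uq' d1).
  rewrite (vderM _ Uq' (sc _) (sxx _)) (vderM _ Uq' (sx _) (sx _)).
  by rewrite vder_cst dx //; ring.
rewrite {1}/d_ (vder_near _ oU Uq d2) (vderM _ Uq (sc _) (sx _)).
by rewrite vder_cst dx //; ring.
Qed.
End CoordinateFunctions.

(** * Flatness of the idempotents when D' = nabla *)

Section FlatIdempotents.
Variables (R : realType) (m : nat) (M : complex_manifold R m).
Local Notation C := (Cx R).
Local Notation V := ('rV[C]_m).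
Variables (g : M -> V -> V -> C) (mul : M -> V -> V -> V) (e E : vfield M) (d : C).
Variables (kappa : M -> V -> V) (nabla D' : operator M).
Hypothesis cdv : cdv_structure g mul e E d kappa nabla D'.
Hypothesis D'_nabla : eq_connection D' nabla.
Variables (U : set M) (u : M -> V) (v : V -> M).
Hypothesis uv : coords_inv U u v.
Local Notation e_ a := (coord_field u a).
Hypothesis canonical : forall q a b, U q ->
  mul q (e_ a q) (e_ b q) = if a == b then e_ a q else 0.

Let frob := cdv_frobenius cdv.
Let cv := cdv_cv cdv.
Let co q (x : V) a := vder q x (fun q => u q 0 a).

Lemma lin_sum (f : V -> V) (I : Type) (r : seq I) (c : I -> C) (x : I -> V) :
  (forall k y z, f (k *: y + z) = k *: f y + f z) ->
  f (\sum_(i <- r) c i *: x i) = \sum_(i <- r) c i *: f (x i).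
Proof.
move=> lf; elim: r => [|i r IH].
  rewrite !big_nil; apply: (addrI (f 0)).
  by rewrite addr0 -{1}[f 0]scale1r -lf scale1r addr0.
by rewrite !big_cons lf IH.
Qed.

Lemma lin0 (f : V -> V) :
  (forall k y z, f (k *: y + z) = k *: f y + f z) -> f 0 = 0.
Proof.
by move=> lf; have := @lin_sum f nat [::] (fun=> 0) (fun=> 0) lf; rewrite !big_nil.
Qed.

Let mull q z : forall k x y, mul q (k *: x + y) z = k *: mul q x z + mul q y z.
Proof. by move=> k x y; exact: frob_mul_linear frob q k x y z. Qed.

Let mulC' q : commutative (mul q).
Proof. exact: frob_mulC frob q. Qed.

Let mulr' q z : forall k x y, mul q z (k *: x + y) = k *: mul q z x + mul q z y.
Proof. by move=> k x y; rewrite !(mulC' q z) mull. Qed.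

Let mulA' q x y z : mul q x (mul q y z) = mul q (mul q x y) z.
Proof. exact: frob_mulA frob q x y z. Qed.

Let mul1l q x : mul q (e q) x = x.
Proof. exact: frob_mul1 frob q x. Qed.

Let kappaK q x : kappa q (kappa q x) = x.
Proof. exact: cdv_kappaK cdv q x. Qed.

Let kappal q k x y : kappa q (k *: x + y) = k^* *: kappa q x + kappa q y.
Proof. exact: cdv_kappa_antilinear cdv q k x y. Qed.

Let kappa0 q : kappa q 0 = 0.
Proof.
apply: (addrI (kappa q 0)); rewrite addr0 -{1}[kappa q 0]scale1r.
by rewrite -(conjC1 C) -kappal scale1r addr0.
Qed.

Let kappaZ q k x : kappa q (k *: x) = k^* *: kappa q x.
Proof. by rewrite -[k *: x]addr0 kappal kappa0 addr0. Qed.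

Let kappaN q x : kappa q (- x) = - kappa q x.
Proof. by rewrite -scaleN1r kappaZ rmorphN1 scaleN1r. Qed.

Let mulN q x y : mul q x (- y) = - mul q x y.
Proof.
by rewrite -scaleN1r -[_ *: y]addr0 mulr' (lin0 (mulr' q x)) addr0 scaleN1r.
Qed.

(** Up to sign this is Ct_y x. *)
Let A q y x := kappa q (mul q y (kappa q x)).
Let w b q := A q (e_ b q) (e q).

Let Al q y k x x' : A q y (k *: x + x') = k *: A q y x + A q y x'.
Proof. by rewrite /A kappal mulr' kappal conjCK. Qed.

Let smooth_e : smooth_field setT e.
Proof. exact/holo_smooth_field/(frob_unit_holo frob). Qed.

Let D'10 := chern_10 (cdv_chern cdv).

Let D'e q x : D' q x e = 0.
Proof. by rewrite (D'_nabla x openT (I : [set: M] q) smooth_e) (frob_unit_flat frob). Qed.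

Let D'0 q x : D' q x (fun=> 0) = 0.
Proof.
have s0 := smooth_field0 (@openT M).
have := conn_add D'10 x openT (I : setT q) s0 s0.
have -> : (fun q : M => (0 : V) + 0) = fun=> 0 by apply/funext => ?; rewrite addr0.
by move=> h; apply: (addrI (D' q x (fun=> 0))); rewrite addr0 -h.
Qed.

Let dbar0 (q : M) x : dbar q x (fun=> 0) = 0.
Proof.
apply/rowP => l; rewrite !mxE /vbarder big1 // => k _.
have -> : (fun q0 : M => vcomp (man_at q) q0 0 0 l) = fun=> 0.
  by apply/funext => q0; rewrite -[0 in LHS](scale0r 0) vcompZ scale0r mxE.
by rewrite -[dzbar _ _ _]/(dzbar k (fun=> 0) _) dzbar_cst mulr0.
Qed.

Let holo_e a : holo_field U (e_ a).
Proof. exact: (holo_coord_field uv a). Qed.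

Let oU : open U := coords_open uv.

Let expand q x : U q -> x = \sum_a co q x a *: e_ a q.
Proof. by move=> Uq; exact: (coord_expand uv x Uq). Qed.

(** This is D'D'' + D''D' = - (C Ct + Ct C) applied to e; the left-hand side
    vanishes since D''e = 0 (e is holomorphic) and D'e = nabla e = 0. *)
Let w_mul_e q a b : U q -> mul q (e_ a q) (w b q) = A q (e_ b q) (e_ a q).
Proof.
move=> Uq; have se := smooth_field_sub (@subsetT _ U) smooth_e.
have := cv_D'D'' cv oU Uq (holo_e a) (holo_e b) se.
have -> : along (@dbar R m M) (e_ b) e = fun=> 0.
  by apply/funext => q'; apply: (dbar_holo _ openT) => //; exact: frob_unit_holo frob.
have -> : along D' (e_ a) e = fun=> 0 by apply/funext => q'; exact: D'e.
rewrite D'0 dbar0 subrr => /esym/eqP; rewrite oppr_eq0 subr_eq0 => /eqP.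
rewrite !(kappaN, mulN, opprK) -/(A q (e_ b q) (e q)) -/(w b q).
by rewrite [mul q (e_ a q) (e q)]mulC' mul1l => ->.
Qed.

(** Both sides are linear in x and agree on the frame (e_a). *)
Let wE q b x : U q -> mul q (w b q) x = A q (e_ b q) x.
Proof.
move=> Uq; rewrite {1 2}(expand x Uq) (lin_sum _ _ _ (mulr' q (w b q))).
rewrite (lin_sum _ _ _ (Al q (e_ b q))); apply: eq_bigr => a _.
by rewrite mulC' w_mul_e.
Qed.

(** By [wE], the square of w_b is the image of e under two applications of
    kappa (e_b o kappa _), which is an idempotent operator. *)
Let w_idem q b : U q -> mul q (w b q) (w b q) = w b q.
Proof.
move=> Uq; rewrite wE // {1}/A /w {1}/A kappaK mulA' canonical // eqxx.
by [].
Qed.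

Let co_lin q k x y a : co q (k *: x + y) a = k * co q x a + co q y a.
Proof. exact: vder_lin. Qed.

Let co_sum q (c : 'I_m -> C) a : U q -> co q (\sum_b c b *: e_ b q) a = c a.
Proof.
move=> Uq; have h r : co q (\sum_(b <- r) c b *: e_ b q) a =
    \sum_(b <- r) c b * (b == a)%:R.
  elim: r => [|b r IH].
    by rewrite !big_nil /co /vder big1 // => k _; rewrite mxE mul0r.
  by rewrite !big_cons co_lin IH /co (vder_coord_field_coord uv).
rewrite h (bigD1 a) //= eqxx mulr1 big1 ?addr0 // => b /negPf ->.
by rewrite mulr0.
Qed.

Let mul_e q a x : U q -> mul q (e_ a q) x = co q x a *: e_ a q.
Proof.
move=> Uq; rewrite {1}(expand x Uq) (lin_sum _ _ _ (mulr' q (e_ a q))).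
rewrite (bigD1 a) //= canonical // eqxx big1 ?addr0 // => b /negPf ba.
by rewrite canonical // eq_sym ba scaler0.
Qed.

Let co_mul q x y a : U q -> co q (mul q x y) a = co q x a * co q y a.
Proof.
move=> Uq; rewrite {1}(expand x Uq) (lin_sum _ _ _ (mull q y)).
under eq_bigr => b _ do rewrite mul_e // scalerA.
by rewrite co_sum.
Qed.

Let s b a q := co q (w b q) a.

Let s_idem b a q : U q -> s b a q * s b a q = s b a q.
Proof. by move=> Uq; rewrite /s -co_mul // w_idem. Qed.

(** The product is only known to be smooth on holomorphic fields. But
    e_b o kappa e is a multiple of e_b, by a component of kappa e. *)
Let smooth_w b : smooth_field U (w b).
Proof.
have sk : smooth_field U (fun q => kappa q (e q)).
  by apply: (cdv_kappa_smooth cdv) => //; exact: smooth_field_sub smooth_e.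
have hu a := holo_smooth_fun (coord_holo_fun uv a).
apply: (cdv_kappa_smooth cdv) => //.
apply: (smooth_field_eq oU (X := fun q => co q (kappa q (e q)) b *: e_ b q)).
  by move=> q Uq; rewrite mul_e.
apply: smooth_fieldZ => //; last exact/holo_smooth_field/holo_e.
exact: smooth_vder.
Qed.

Let smooth_s b a : smooth_fun U (s b a).
Proof.
apply: smooth_vder => //; exact: holo_smooth_fun (coord_holo_fun uv a).
Qed.

(** Differentiating s^2 = s gives 2 s s' = s', and multiplying by s then gives
    s s' = 0. *)
Let vder_s b a q x : U q -> vder q x (s b a) = 0.
Proof.
move=> Uq; have h := vder_near x oU Uq (s_idem b a).
have := s_idem b a Uq; move: h.
rewrite (vderM _ Uq (smooth_s _ _) (smooth_s _ _)).
move: (vder q x _) (s b a q) => t c ht hc.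
have tc : t * c = 0.
  apply: (addrI (t * c)); rewrite addr0; have := congr1 (fun x => x * c) ht.
  by rewrite /= mulrDl -mulrA hc mulrAC hc [c * t]mulrC.
by rewrite -ht [c * t]mulrC tc addr0.
Qed.

Let D'_lin q a k x y : smooth_field U a -> U q ->
  D' q (k *: x + y) a = k *: D' q x a + D' q y a.
Proof. by move=> sa Uq; exact: (conn_linear D'10 k x y oU Uq sa). Qed.

(** This is D'(Ct) = 0, which expresses part of (Ct + D')^2 = 0, applied to e:
    up to sign w_b is Ct_(e_b) e, and D'e = 0. *)
Let w_flat q b x : U q -> D' q x (w b) = 0.
Proof.
move=> Uq; have se := smooth_field_sub (@subsetT _ U) smooth_e.
have base a : D' q (e_ a q) (w b) = 0.
  have := cv_D'Ct cv oU Uq (holo_e a) (holo_e b) se.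
  rewrite D'e kappa0 (lin0 (mulr' q (e_ b q))) oppr0 kappa0 subr0.
  have -> : (fun q0 => kappa q0 (- mul q0 (e_ b q0) (kappa q0 (e q0)))) =
      fun q => (-1) *: w b q.
    by apply/funext => q'; rewrite kappaN scaleN1r.
  rewrite (conn_leibniz D'10 _ oU Uq (smooth_fun_cst _ (-1)) (smooth_w b)).
  by rewrite vder_cst scale0r add0r scaleN1r => /eqP; rewrite oppr_eq0 => /eqP.
rewrite (expand x Uq) (lin_sum (f := fun x => D' q x (w b))) => [|k y z].
  by rewrite big1 // => a _; rewrite base scaler0.
exact: D'_lin.
Qed.

Let D'_sum q x (I : Type) (r : seq I) (X : I -> vfield M) : U q ->
  (forall i, smooth_field U (X i)) ->
  D' q x (fun q => \sum_(i <- r) X i q) = \sum_(i <- r) D' q x (X i).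
Proof.
move=> Uq sX; elim: r => [|i r IH].
  rewrite big_nil -[RHS](D'0 q x); congr (D' q x _).
  by apply/funext => q'; rewrite big_nil.
rewrite big_cons -IH -(conn_add D'10 _ oU Uq (sX i) (smooth_field_sum _ oU sX)).
by congr (D' q x _); apply/funext => q'; rewrite big_cons.
Qed.

(** The equation D' w_b = 0 in the frame (e_a), where the components of w_b
    have vanishing derivatives. *)
Let s_D' q b x : U q -> \sum_a s b a q *: D' q x (e_ a) = 0.
Proof.
move=> Uq; apply: etrans (w_flat b x Uq); apply/esym.
have sse a : smooth_field U (fun q => s b a q *: e_ a q).
  by apply: smooth_fieldZ => //; exact/holo_smooth_field/holo_e.
have -> : D' q x (w b) = D' q x (fun q => \sum_a s b a q *: e_ a q).
  apply: (conn_local D'10 _ oU Uq) => //; first exact: smooth_field_sum.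
  by move=> q' Uq'; exact: expand.
rewrite D'_sum //; apply: eq_bigr => a _.
rewrite (conn_leibniz D'10 _ oU Uq (smooth_s b a) (holo_smooth_field (holo_e a))).
by rewrite vder_s // scale0r add0r.
Qed.

Let Smx q : 'M[C]_m := \matrix_(b, a) s b a q.

(** A linear relation between the w_b yields, after multiplication by kappa e,
    the same relation between the kappa e_b, hence the conjugate one between
    the e_b. *)
Let Smx_unit q : U q -> Smx q \in unitmx.
Proof.
move=> Uq; rewrite -row_free_unit -kermx_eq0; apply/rowV0P => r /sub_kermxP rS.
have rw0 : \sum_b r 0 b *: w b q = 0.
  rewrite [LHS](expand _ Uq) big1 // => a _.
  have -> : co q (\sum_b r 0 b *: w b q) a = (r *m Smx q) 0 a.
    rewrite mxE; elim: (index_enum _) => [|b t IH].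
      by rewrite !big_nil /co /vder big1 // => k _; rewrite mxE mul0r.
    by rewrite !big_cons co_lin IH mxE.
  by rewrite rS mxE scale0r.
have rk0 : \sum_b r 0 b *: kappa q (e_ b q) = 0.
  have := lin_sum (index_enum _) (r 0) (w^~ q) (mull q (kappa q (e q))).
  rewrite rw0 (lin0 (mull q (kappa q (e q)))) => /esym; apply: etrans.
  apply: eq_bigr => b _.
  by rewrite wE // /A kappaK [mul q (e_ b q) _]mulC' mul1l.
have re0 : \sum_b (r 0 b)^* *: e_ b q = 0.
  apply: etrans (kappa0 q).
  have {2}<- := rk0; elim: (index_enum _) => [|b t IH].
    by rewrite !big_nil kappa0.
  by rewrite !big_cons kappal -IH kappaK.
apply/rowP => b; rewrite mxE -[LHS]conjCK -(co_sum (fun b => (r 0 b)^*) b Uq) re0.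
by rewrite /co /vder big1 ?conjC0 // => k _; rewrite mxE mul0r.
Qed.

Let D'_e_ q x a : U q -> D' q x (e_ a) = 0.
Proof.
move=> Uq; pose B : 'M[C]_m := \matrix_a D' q x (e_ a).
have SB : Smx q *m B = 0.
  apply/row_matrixP => b; rewrite row_mul mulmx_sum_row row0 -[RHS](s_D' b x Uq).
  by apply: eq_bigr => k _; rewrite !mxE rowK.
have B0 : B = 0 by rewrite -[B]mul1mx -(mulVmx (Smx_unit Uq)) -mulmxA SB mulmx0.
by have := congr1 (row a) B0; rewrite rowK row0.
Qed.

Lemma canonical_flat q x a : U q -> nabla q x (e_ a) = 0.
Proof.
move=> Uq; by rewrite -(D'_nabla x oU Uq (holo_smooth_field (holo_e a))) D'_e_.
Qed.

Lemma canonical_metric_vder a q x : U q ->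
  vder q x (fun q => g q (e_ a q) (e_ a q)) = 0.
Proof.
move=> Uq; rewrite (lc_metric (frob_levi_civita frob) x oU Uq (holo_e a) (holo_e a)).
rewrite canonical_flat // [g q (e_ a q) 0](frob_g_sym frob).
have g0 z : g q 0 z = 0.
  have := frob_g_linear frob q 1 0 0 z; rewrite scaler0 addr0 mul1r => h.
  by apply: (addrI (g q 0 z)); rewrite addr0 -h.
by rewrite g0 addr0.
Qed.

(** For j <> k, g(e_j, e_k) = g(e_j o e_j, e_k) = g(e_j, e_j o e_k) = 0. *)
Lemma canonical_structure_constants q i j k : U q ->
  g q (mul q (e_ i q) (e_ j q)) (e_ k q) =
  (i == j)%:R * (i == k)%:R * g q (e_ k q) (e_ k q).
Proof.
move=> Uq; have g0 z : g q 0 z = 0.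
  have := frob_g_linear frob q 1 0 0 z; rewrite scaler0 addr0 mul1r => h.
  by apply: (addrI (g q 0 z)); rewrite addr0 -h.
rewrite canonical //; case: eqP => [->|_]; last by rewrite !mul0r g0.
rewrite mul1r; case: eqP => [->|/eqP/negPf jk]; first by rewrite mul1r.
have := frob_invariant frob q (e_ j q) (e_ j q) (e_ k q).
rewrite !canonical // eqxx jk (frob_g_sym frob q (e_ j q) 0) g0 => ->.
by rewrite mul0r.
Qed.

(** The neighbourhood is the part of U over a ball around u p, which is
    connected, so that g(e_a, e_a) is constant on it. *)
Lemma canonical_cubic_potential p : U p -> exists U' t (P : mpoly m C),
    [/\ U' p, flat_coords nabla U' t, (msize P <= 4)%N &
        potential g mul U' t (fun q => meval (fun i => t q 0 i) P)].
Proof.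
move=> Up; have ouU : open (u @` U) by case: uv.1.
have nUp : nbhs (u p) (u @` U) by apply: open_nbhs_nbhs; split=> //; exists p.
have [r /= r0 sB] := (nbhs_ballP (u p) _).1 nUp.
pose O := [set q | U q /\ ball (u p) r (u q)].
have sO : O `<=` U by move=> q [].
have oO : open O.
  by apply: (chart_preimage_open uv.1); exact: ball_open.
pose eta a q := g q (e_ a q) (e_ a q).
have eta_cst a q : O q -> eta a q = eta a p.
  move=> [Uq Bq]; apply: (holo_fun_constant uv _ _ Up sB r0 Uq Bq).
    exact: (frob_g_holo frob oU (holo_e a) (holo_e a)).
  by move=> q' b Uq'; exact: canonical_metric_vder.
have uvO := coords_inv_sub uv oO sO.
exists O, u, (cubic (fun a => eta a p / 6)); split.
- by split=> //; exact: ballxx.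
- split; first by exists v.
  by move=> i q x [Uq _]; exact: canonical_flat.
- exact: msize_cubic.
- set F := fun q => _.
  have FE : F = fun q => \sum_l eta l p / 6 * (u q 0 l * (u q 0 l * u q 0 l)).
    by apply/funext => q; rewrite /F meval_cubic.
  rewrite FE; split.
    exact/(holo_fun_sub sO)/(holo_fun_cubic uv).
  move=> i j k q [Uq Bq].
  rewrite (cubic_derivatives uv (fun l => eta l p / 6) i j k Uq).
  rewrite canonical_structure_constants // -/(eta k q) eta_cst //.
  have six : (6 : C) != 0 by rewrite pnatr_eq0.
  have [->|jk] := eqVneq j k; last first.
    by rewrite mulr0 mul0r; case: eqP => [->|_]; rewrite ?(negPf jk) ?mulr0 !mul0r.
  by case: eqP => _; rewrite ?mulr0 ?mul0r // mulr1n !mulr1 !mul1r mulrC divfK.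
Qed.
End FlatIdempotents.

Theorem corollary2p8 (R : realType) (m : nat) (M : complex_manifold R m)
  (g : M -> 'rV[Cx R]_m -> 'rV[Cx R]_m -> Cx R)
  (mul : M -> 'rV[Cx R]_m -> 'rV[Cx R]_m -> 'rV[Cx R]_m)
  (e E : vfield M) (d : Cx R)
  (kappa : M -> 'rV[Cx R]_m -> 'rV[Cx R]_m)
  (nabla D' : operator M) :
  cdv_structure g mul e E d kappa nabla D' ->
  ~ trivial g nabla mul ->
  semisimple mul ->
  ~ eq_connection D' nabla.
Proof.
move=> cdv nontriv ss D'_nabla; apply: nontriv => p.
have [U [u [Up [v [uP vP]] canonical]]] := ss p.
exact: (canonical_cubic_potential cdv D'_nabla (conj uP vP) canonical Up).
Qed.
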